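(* Let $n\ge1$, let $F$ be an $n$-perturbation on $H^2(\mathbb{D})$, and let $\mathcal{M}$ be a nonzero closed subspace of $H^2(\mathbb{D})$. Then $\mathcal{M}$ is invariant under $S_n = M_z + F$ if and only if there exist an inner function $\theta \in H^\infty(\mathbb{D})$ and polynomials $p_0,\dots,p_{n-1},q_0,\dots,q_{n-1} \in \mathbb{C}[z]$ such that \[\mathcal{M} = (\mathbb{C}\varphi_0 \oplus \mathbb{C}\varphi_1 \oplus \cdots \oplus \mathbb{C}\varphi_{n-1}) \oplus z^n\theta H^2(\mathbb{D}),\] where $\varphi_i = z^i p_i \theta - q_i$ for all $i = 0, \ldots, n-1$, and \[S_n\varphi_j \in (\mathbb{C}\varphi_{j+1} \oplus \cdots \oplus \mathbb{C}\varphi_{n-1})\oplus z^n\theta H^2(\mathbb{D})\] for all $j = 0, \ldots, n-2$, and $S_n\varphi_{n-1} = z^n p_{n-1}\theta$.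
   Context: $H^2(\mathbb{D})$ is the Hardy space on the open unit disc, $H^\infty(\mathbb{D})$ the bounded analytic functions on $\mathbb{D}$, and $M_z$ the unilateral shift on $H^2(\mathbb{D})$. All operators are bounded. A linear operator $F$ on $H^2(\mathbb{D})$ is an $n$-perturbation if (a) $Fz^m = 0$ for all $m \ge n$; (b) $F(z^m H^2(\mathbb{D})) \subseteq z^{m+1}\mathbb{C}[z]$ for all $m \ge 0$; and (c) $M_z + F$ is left-invertible. The symbol $\oplus$ denotes orthogonal direct sum. *)

(* Defs.v *)
From mathcomp Require Import all_boot all_order all_algebra.
From mathcomp Require Import all_classical all_reals all_analysis.
From mathcomp.real_closed Require Import complex.
Import Order.TTheory GRing.Theory Num.Theory numFieldNormedType.Exports.

Set Implicit Arguments.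
Unset Strict Implicit.
Unset Printing Implicit Defensive.

Local Open Scope ring_scope.
Local Open Scope classical_set_scope.

(* Conventions: the complex field is C := R[i] for an arbitrary R : realType.
   H^2(D) is modelled, via the (isometric) Taylor-coefficient identification
   f(z) = sum_k f_k z^k, as the space of square-summable coefficient sequences
   f : nat -> C.  All "vectors" below are coefficient sequences. *)

Section Hardy.
Context {R : realType}.
Local Notation C := R[i].

Definition cmod (z : C) : R := Num.sqrt (complex.Re z ^+ 2 + complex.Im z ^+ 2).

Definition cseries_to (c : nat -> C) (l : C) : Prop :=
  (fun N => cmod (\sum_(k < N) c k - l)) @ \oo --> (0 : R).

Definition is_H2 (f : nat -> C) : Prop :=
  cvg (series (fun k => cmod (f k) ^+ 2) @ \oo).

Definition h2norm (f : nat -> C) : R :=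
  Num.sqrt (limn (series (fun k => cmod (f k) ^+ 2))).

Definition h2orth (f g : nat -> C) : Prop :=
  cseries_to (fun k => f k * Num.conj (g k)) 0.

Definition coefs (p : {poly C}) : nat -> C := fun k => p`_k.

Definition zpow (m : nat) : nat -> C := fun k => (k == m)%:R.

Definition cmul (a b : nat -> C) : nat -> C :=
  fun k => \sum_(j < k.+1) a j * b (k - j)%N.

Definition Mz (f : nat -> C) : nat -> C :=
  fun k => if k is k'.+1 then f k' else 0.

Definition bounded_op (T : (nat -> C) -> (nat -> C)) : Prop :=
  [/\ forall f, is_H2 f -> is_H2 (T f),
      forall (a : C) f g, is_H2 f -> is_H2 g ->
        T (fun k => a * f k + g k) = (fun k => a * T f k + T g k)
    & exists B : R, forall f, is_H2 f -> h2norm (T f) <= B * h2norm f].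

Definition left_invertible (T : (nat -> C) -> (nat -> C)) : Prop :=
  exists L, bounded_op L /\ forall f, is_H2 f -> L (T f) = f.

Definition Sop (F : (nat -> C) -> (nat -> C)) (f : nat -> C) : nat -> C :=
  fun k => Mz f k + F f k.

Definition n_perturbation (n : nat) (F : (nat -> C) -> (nat -> C)) : Prop :=
  [/\ bounded_op F,
      forall m, (n <= m)%N -> F (zpow m) = (fun _ => 0),
      (* (b) F (z^m H^2) \subseteq z^(m+1) C[z] *)
      forall m f, is_H2 f -> (forall k, (k < m)%N -> f k = 0) ->
        exists p : {poly C}, F f = coefs p /\ forall k, (k < m.+1)%N -> p`_k = 0
    &
      left_invertible (Sop F)].

Definition closed_subspace (M : set (nat -> C)) : Prop :=
  [/\ forall f, M f -> is_H2 f,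
      M (fun _ => 0),
      forall (a : C) f g, M f -> M g -> M (fun k => a * f k + g k)
    & forall (u : nat -> nat -> C) f, (forall i, M (u i)) -> is_H2 f ->
        (fun i => h2norm (fun k => u i k - f k)) @ \oo --> (0 : R) -> M f].

Definition Hinf_fun (c : nat -> C) (theta_fun : C -> C) : Prop :=
  (forall z : C, cmod z < 1 -> cseries_to (fun k => c k * z ^+ k) (theta_fun z))
  /\ exists B : R, forall z : C, cmod z < 1 -> cmod (theta_fun z) <= B.

Definition inner (c : nat -> C) : Prop :=
  exists theta_fun, Hinf_fun c theta_fun /\
    {ae (@lebesgue_measure R), forall t : R, `[0, 2 * pi] t ->
       exists l : C,
         cmod (theta_fun (Complex (r * cos t) (r * sin t)) - l)
            @[r --> (1 : R)^'-] --> (0 : R)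
         /\ cmod l = 1}.

End Hardy.

(* Main.v *)
Require Import Defs.
From mathcomp Require Import all_boot all_order all_algebra.
From mathcomp Require Import all_classical all_reals all_analysis.
From mathcomp.real_closed Require Import complex.
From mathcomp Require Import measurable_realfun ring lra.
From HB Require Import structures.
Import Order.TTheory GRing.Theory Num.Theory numFieldNormedType.Exports.

(** Write [S = M_z + F] and [M_i] for the elements of [M] divisible by [z^i]. The operator [F]
    kills [z^n H^2], so [S] is the shift there; since [S] is injective and [S M_i] is contained
    in [M_(i+1)], the space [M_n] is [z^n] times a nonzero shift-invariant subspace, and Beurling's
    theorem gives [M_n = z^n theta H^2]. Each [M_i / M_(i+1)] has dimension at most one; let
    [phi_i] span the orthogonal complement of [M_(i+1)] in [M_i]. Then [S^(n-i) phi_i] lies in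
    [z^n theta H^2] and differs from [z^(n-i) phi_i] by a polynomial, so that
    [phi_i = z^i theta h - q] with [q] a polynomial; orthogonality to [z^n theta z^j] for large
    [j] forces [h] to be a polynomial as well.

    In coefficient space Beurling's theorem yields [theta] with orthonormal shifts [z^k theta].
    Bessel's inequality for the Szego kernel gives [|theta| <= 1] on the disc. The partial Fourier
    sums of [theta] converge in [L^1] along a subsequence to a boundary function whose Poisson
    integral is [theta]; at its Lebesgue points the radial limit exists. By bounded convergence
    the mean square of the radial limit is the norm of [theta], namely one, so that its modulus
    is one almost everywhere. *)

Set Implicit Arguments.
Unset Strict Implicit.
Unset Printing Implicit Defensive.
Local Open Scope ring_scope.
Local Open Scope classical_set_scope.

(** * Integration *)

Definition cutoff {V : zmodType} M (F : nat -> V) : nat -> V :=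
  fun k => if (k < M)%N then 0 else F k.

Lemma sum_cutoff (V : zmodType) (F : nat -> V) M N : (M <= N)%N ->
  \sum_(k < N) cutoff M F k = \sum_(k < N) F k - \sum_(k < M) F k.
Proof.
elim: N => [|N IH]; first by rewrite leqn0 => /eqP->; rewrite !big_ord0 subrr.
rewrite leq_eqVlt => /predU1P[->|].
  by rewrite subrr big1// => k _; rewrite /cutoff ltn_ord.
by rewrite ltnS => MN; rewrite !big_ord_recr/= IH// /cutoff ltnNge MN/= addrAC.
Qed.

Section RealSequences.
Context {R : realType}.
Implicit Types u v e : nat -> R.

Lemma squeeze_norm_cvg0 u v : (forall n, `|u n| <= v n) ->
  v @ \oo --> (0 : R) -> u @ \oo --> (0 : R).
Proof.
move=> uv v0; apply/norm_cvg0P.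
apply: (@squeeze_cvgr _ _ _ _ (fun=> 0) v) => //; last exact: cvg_cst.
by apply: nearW => n; rewrite normr_ge0 uv.
Qed.

Lemma cvg0_sqr_eq0 (x : R) u : (\forall n \near \oo, x ^+ 2 <= u n) ->
  u @ \oo --> (0 : R) -> x = 0.
Proof.
move=> xu u0; apply/eqP; rewrite -sqrf_eq0 eq_le sqr_ge0 andbT.
exact: cvgr_to_ge u0 xu.
Qed.

Lemma cvgn_of_sqr_dist u e : e @ \oo --> (0 : R) ->
  (forall i j, (i <= j)%N -> (u i - u j) ^+ 2 <= e i) -> cvgn u.
Proof.
move=> e0 ue; apply/cauchy_cvgP/cauchyP => d d0.
have d2 : 0 < (d / 2) ^+ 2 by rewrite exprn_gt0// divr_gt0.
have /cvgr0_norm_lt/(_ _ d2)[N _ HN] := e0.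
exists (u N); exists N => // i /= Ni; rewrite -ball_normE/=.
have half_d : d / 2 < d by rewrite ltr_pdivrMr// ltr_pMr// ltr1n.
apply: lt_trans half_d; rewrite -ltr_sqr ?nnegrE ?divr_ge0 ?(ltW d0)//.
rewrite real_normK ?num_real//; apply: le_lt_trans (ue _ _ Ni) _.
exact: le_lt_trans (ler_norm _) (HN N (leqnn N)).
Qed.

Lemma cvg_subseq (n_ : nat -> nat) {T : topologicalType} (u : nat -> T) (l : T) :
  (forall k, (k <= n_ k)%N) -> u @ \oo --> l -> (u \o n_) @ \oo --> l.
Proof.
move=> kn; apply: cvg_comp => P [N _ HN].
by exists N => // k /= Nk; apply: HN => /=; exact: leq_trans (kn k).
Qed.

Lemma fast_subseq e (d : nat -> R) : e @ \oo --> (0 : R) -> (forall k, 0 < d k) ->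
  exists n_ : nat -> nat, [/\ forall k, (k <= n_ k)%N,
    forall k, (n_ k <= n_ k.+1)%N & forall k N, (n_ k <= N)%N -> `|e N| <= d k].
Proof.
move=> e0 d_gt0.
have /choice[K KP] k : exists K, forall N, (K <= N)%N -> `|e N| <= d k.
  have /cvgr0_norm_le/(_ _ (d_gt0 k))[K _ KP] := e0.
  by exists K => N KN; exact: KP.
pose n_ k := (\sum_(j < k.+1) (K j).+1)%N.
have nS k : n_ k.+1 = (n_ k + (K k.+1).+1)%N by rewrite /n_ big_ord_recr.
exists n_; split=> [k|k|k N nN].
- by elim: k => // k IH; rewrite nS -addn1 leq_add.
- by rewrite nS leq_addr.
- apply: KP; apply: leq_trans nN; rewrite /n_ big_ord_recr/=.
  exact: leq_trans (leqnSn _) (leq_addl _ _).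
Qed.

Lemma norm_le_increments u k :
  `|u k| <= `|u 0%N| + \sum_(0 <= j < k) `|u j.+1 - u j|.
Proof.
rewrite -[u k](subrK (u 0%N)) addrC (le_trans (ler_normD _ _))// lerD2l.
by rewrite -(telescope_sumr u (leq0n k)) ler_norm_sum.
Qed.

Lemma cvgn_abs_increments u :
  cvgn (series (fun k => `|u k.+1 - u k|)) -> cvgn u.
Proof.
move=> /(@normed_cvg R R (telescope u)) /cvg_ex[l cl].
apply/cvg_ex; exists (u 0%N + l).
have uE : u = (fun k => u 0%N + series (telescope u) k).
  by apply/funext => k; exact: eq_sum_telescope.
by rewrite [X in X @ _]uE; apply: cvgD => //; exact: cvg_cst.
Qed.

End RealSequences.

Section RealIntegral.
Context d (T : measurableType d) (R : realType) (mu : {measure set T -> \bar R}).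
Variable D : set T.
Hypothesis mD : measurable D.
Implicit Types f g : T -> R.

Lemma integrable_EFinD f g : mu.-integrable D (EFin \o f) ->
  mu.-integrable D (EFin \o g) -> mu.-integrable D (EFin \o (fun x => f x + g x)).
Proof. by move=> fi gi; exact: (integrableD mD fi gi). Qed.

Lemma integrable_EFinB f g : mu.-integrable D (EFin \o f) ->
  mu.-integrable D (EFin \o g) -> mu.-integrable D (EFin \o (fun x => f x - g x)).
Proof. by move=> fi gi; exact: (integrableB mD fi gi). Qed.

Lemma integrable_EFinZ (c : R) f : mu.-integrable D (EFin \o f) ->
  mu.-integrable D (EFin \o (fun x => c * f x)).
Proof. by move=> fi; exact: (integrableZl mD c fi). Qed.

Lemma integrable_EFin_norm f : mu.-integrable D (EFin \o f) ->
  mu.-integrable D (EFin \o (fun x => `|f x|)).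
Proof. exact: integrable_abse. Qed.

Lemma integrable_EFin_sum n (F : nat -> T -> R) :
  (forall k, mu.-integrable D (EFin \o F k)) ->
  mu.-integrable D (EFin \o (fun x => \sum_(k < n) F k x)).
Proof.
move=> Fi; rewrite (_ : EFin \o _ = fun x => (\sum_(k < n) (F k x)%:E)%E).
  by apply: integrable_sum => // k _; exact: Fi.
by apply/funext => x; rewrite /= sumEFin.
Qed.

Lemma EFin_Rintegral f : mu.-integrable D (EFin \o f) ->
  ((\int[mu]_(x in D) f x)%R%:E = \int[mu]_(x in D) (f x)%:E)%E.
Proof. by move=> fi; rewrite fineK//; exact: integrable_fin_num. Qed.

Lemma Rintegral_sum n (F : nat -> T -> R) :
  (forall k, mu.-integrable D (EFin \o F k)) ->
  (\int[mu]_(x in D) (\sum_(k < n) F k x) =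
   \sum_(k < n) \int[mu]_(x in D) F k x)%R.
Proof.
move=> Fi; elim: n => [|n IH].
  by under eq_Rintegral do rewrite big_ord0; rewrite big_ord0 Rintegral_cst ?mul0r.
under eq_Rintegral do rewrite big_ord_recr.
by rewrite big_ord_recr/= -IH RintegralD//; exact: integrable_EFin_sum.
Qed.

Lemma integrable_EFinM (B : R) f g : measurable_fun D g ->
  (forall x, D x -> `|g x| <= B) -> mu.-integrable D (EFin \o f) ->
  mu.-integrable D (EFin \o (fun x => g x * f x)).
Proof.
move=> mg gB fi; have mf : measurable_fun D f.
  by apply/measurable_EFinP; exact: measurable_int fi.
apply: (le_integrable mD _ _ (integrable_EFinZ B fi)) => [|x Dx /=].
  exact/measurable_EFinP/measurable_funM.
by rewrite lee_fin !normrM ler_wpM2r// (le_trans (gB x Dx))// ler_norm.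
Qed.

Lemma cvg_Rintegral_mul_bounded (B : R) g f (F : nat -> T -> R) :
  measurable_fun D g -> (forall x, D x -> `|g x| <= B) ->
  (forall k, mu.-integrable D (EFin \o F k)) -> mu.-integrable D (EFin \o f) ->
  (fun k => \int[mu]_(x in D) `|F k x - f x|)%R @ \oo --> (0 : R) ->
  (fun k => \int[mu]_(x in D) (g x * F k x))%R @ \oo -->
    (\int[mu]_(x in D) (g x * f x))%R.
Proof.
move=> mg gB Fi fi F_f; apply/subr_cvg0.
have gi h : mu.-integrable D (EFin \o h) ->
    mu.-integrable D (EFin \o (fun x => g x * h x)).
  exact: integrable_EFinM mg gB.
apply: (@squeeze_norm_cvg0 _ _ (fun k => B * \int[mu]_(x in D) `|F k x - f x|)%R).
  move=> k; have di := integrable_EFinB (Fi k) fi.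
  rewrite -RintegralB; [|exact: mD|exact: gi|exact: gi].
  under eq_Rintegral do rewrite -mulrBr.
  apply: le_trans (le_normr_Rintegral mD (gi _ di)) _.
  rewrite -RintegralZl//; last exact: integrable_EFin_norm.
  apply: le_Rintegral => //.
  - by apply: integrable_EFin_norm; exact: gi.
  - by apply: integrable_EFinZ; exact: integrable_EFin_norm.
  - by move=> x Dx; rewrite normrM ler_wpM2r ?gB.
by rewrite -[X in _ --> X](mulr0 B); apply: cvgM => //; exact: cvg_cst.
Qed.

Lemma cvg_Rintegral_bounded (B : R) f (F : nat -> T -> R) :
  (mu D < +oo)%E -> (forall k, measurable_fun D (F k)) -> measurable_fun D f ->
  (forall k x, D x -> `|F k x| <= B) ->
  {ae mu, forall x, D x -> F ^~ x @ \oo --> f x} ->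
  mu.-integrable D (EFin \o f) /\
  (fun k => \int[mu]_(x in D) F k x)%R @ \oo --> (\int[mu]_(x in D) f x)%R.
Proof.
move=> fD mF mf FB F_f.
have Bi : mu.-integrable D (EFin \o (fun=> B)).
  by apply: measurable_bounded_integrable => //; exact: bounded_cst.
have Fi k : mu.-integrable D (EFin \o F k).
  apply: measurable_bounded_integrable => //.
  exists B; split; first exact: num_real.
  by move=> c Bc x Dx; exact: le_trans (FB k x Dx) (ltW Bc).
have [||||fi _ cv] := @dominated_convergence _ _ _ mu D mD
  (fun k => EFin \o F k) (EFin \o f) (EFin \o (fun=> B)) _ _ _ Bi.
- by move=> k; exact/measurable_EFinP.
- exact/measurable_EFinP.
- by apply: filterS F_f => x /[apply] Fx; apply: cvg_EFin => //; exact: nearW.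
- by apply: aeW => x k Dx /=; rewrite lee_fin FB.
split=> //; apply: fine_cvg; rewrite EFin_Rintegral//.
Qed.

Lemma Rintegral_eq0_ae f : mu.-integrable D (EFin \o f) ->
  {ae mu, forall x, D x -> 0 <= f x} -> (\int[mu]_(x in D) f x <= 0)%R ->
  {ae mu, forall x, D x -> f x = 0}.
Proof.
move=> fi f_ge0 int_le0; have mf := measurable_int _ fi.
have norm_eq : ae_eq mu D (abse \o (EFin \o f)) (EFin \o f).
  by apply: filterS f_ge0 => x /[apply] fx; rewrite /= ger0_norm.
have int_norm : (\int[mu]_(x in D) `|(f x)%:E| = \int[mu]_(x in D) (f x)%:E)%E.
  by apply: ae_eq_integral => //; exact: measurableT_comp.
have /(ae_eq_integral_abs mu mD mf).1 : (\int[mu]_(x in D) `|(f x)%:E| = 0)%E.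
  apply/eqP; rewrite eq_le integral_ge0 ?andbT// int_norm.
  by rewrite -EFin_Rintegral// lee_fin.
by apply: filterS => x /[apply] -[].
Qed.

Lemma Rintegral_norm_le_sqr f (e : R) : 0 < e -> (mu D < +oo)%E ->
  measurable_fun D f -> mu.-integrable D (EFin \o (fun x => f x ^+ 2)) ->
  (\int[mu]_(x in D) `|f x| <=
    e * fine (mu D) + e^-1 * \int[mu]_(x in D) (f x ^+ 2))%R.
Proof.
move=> e0 fD mf fi.
have ei : mu.-integrable D (EFin \o (fun=> e)).
  by apply: measurable_bounded_integrable => //; exact: bounded_cst.
rewrite -RintegralZl// -Rintegral_cst// -RintegralD//; last exact: integrable_EFinZ.
have sum_i : mu.-integrable D (EFin \o (fun x => e + e^-1 * f x ^+ 2)).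
  by apply: integrable_EFinD => //; exact: integrable_EFinZ.
have amgm x : `|f x| <= e + e^-1 * f x ^+ 2.
  rewrite -(real_normK (num_real (f x))); set y := `|f x|.
  rewrite -subr_ge0 (_ : _ - _ = e^-1 * ((e - y / 2) ^+ 2 + 3 / 4 * y ^+ 2)).
    by rewrite mulr_ge0 ?invr_ge0 ?(ltW e0)// addr_ge0 ?sqr_ge0// mulr_ge0 ?sqr_ge0.
  by field; rewrite lt0r_neq0.
apply: le_Rintegral => //; apply: (le_integrable mD _ _ sum_i) => [|x Dx].
  by apply/measurable_EFinP; exact: measurableT_comp.
by rewrite /= lee_fin normr_id (le_trans (amgm x))// ler_norm.
Qed.

Section L1Complete.
Variable F : nat -> T -> R.
Hypothesis Fi : forall k, mu.-integrable D (EFin \o F k).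
Hypothesis F_summable :
  (\sum_(0 <= k <oo) \int[mu]_(x in D) `|F k.+1 x - F k x|%:E < +oo)%E.

Let increments x : \bar R := (\sum_(0 <= k <oo) `|F k.+1 x - F k x|%:E)%E.

Let mF k : measurable_fun D (F k).
Proof. by apply/measurable_EFinP; exact: measurable_int (Fi k). Qed.

Let measurable_increment k : measurable_fun D (fun x => `|F k.+1 x - F k x|%:E).
Proof.
by apply/measurable_EFinP/measurableT_comp => //; exact: measurable_funB.
Qed.

Let increments_integrable : mu.-integrable D increments.
Proof.
apply/integrableP; split.
  apply: (eq_measurable_fun
    (fun x => \sum_(k <oo | k \in xpredT) `|F k.+1 x - F k x|%:E)%E).
    by move=> x _; exact: eq_eseriesl.
  apply: ge0_emeasurable_sum => [k x _ _|k _]; first by rewrite lee_fin.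
  exact: measurable_increment.
under eq_integral do rewrite gee0_abs ?nneseries_ge0//.
by rewrite integral_nneseries// => k x _; rewrite lee_fin.
Qed.

Let cvg_ae : {ae mu, forall x, D x -> cvgn (F ^~ x)}.
Proof.
apply: filterS (integrable_ae mD increments_integrable) => x /[apply] fin_x.
apply: cvgn_abs_increments; apply: nondecreasing_is_cvgn.
  by apply: nondecreasing_series.
exists (fine (increments x)) => _ [k _ <-].
rewrite -lee_fin fineK// /series/= -sumEFin.
by apply: nneseries_lim_ge => j _ _; rewrite lee_fin.
Qed.

Lemma L1_complete : exists2 f, mu.-integrable D (EFin \o f) &
  (fun k => \int[mu]_(x in D) `|F k x - f x|)%R @ \oo --> (0 : R).
Proof.
pose f x := fine (limn_esup (fun k => (F k x)%:E)).
have mf : measurable_fun D (EFin \o f).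
  apply/measurable_EFinP; apply: (measurableT_comp (fine_measurable measurableT)).
  apply: (measurable_fun_limn_esup (f := fun k x => (F k x)%:E)) => k.
  exact/measurable_EFinP.
have F_f : {ae mu, forall x, D x -> (fun k => (F k x)%:E) @ \oo --> (f x)%:E}.
  apply: filterS cvg_ae => x /[apply] /cvg_ex[l Fl].
  have FlE : (fun k => (F k x)%:E) @ \oo --> l%:E by apply: cvg_EFin; first exact: nearW.
  by rewrite /f is_cvg_limn_esupE ?(cvg_lim _ FlE)//; exact: cvgP FlE.
have dominated : {ae mu, forall x k, D x ->
    `|(F k x)%:E| <= `|F 0%N x|%:E + increments x}%E.
  apply: aeW => x k Dx.
  apply: (@le_trans _ _ (`|F 0%N x|%:E + \sum_(0 <= j < k) `|F j.+1 x - F j x|%:E)%E).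
    by rewrite sumEFin -EFinD lee_fin (norm_le_increments (F ^~ x)).
  by rewrite leeD2l//; apply: nneseries_lim_ge => j _ _; rewrite lee_fin.
have dominant : mu.-integrable D (fun x => `|F 0%N x|%:E + increments x)%E.
  by apply: integrableD => //; exact: integrable_EFin_norm.
have [|fi cv _] := dominated_convergence mD _ mf F_f dominant dominated.
  by move=> k; exact/measurable_EFinP.
exists f => //; move: cv; rewrite (_ : (fun k => _) =
    (fun k => (\int[mu]_(x in D) `|F k x - f x|)%R%:E)); first by move/fine_cvgP => [].
apply/funext => k; rewrite EFin_Rintegral//.
by apply: integrable_EFin_norm => //; exact: integrable_EFinB.
Qed.

End L1Complete.

Lemma L1_complete_fast_L2 (F : nat -> T -> R) : (mu D < +oo)%E ->
  (forall k, mu.-integrable D (EFin \o F k)) ->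
  (forall k, mu.-integrable D (EFin \o (fun x => (F k.+1 x - F k x) ^+ 2))) ->
  (forall k, \int[mu]_(x in D) ((F k.+1 x - F k x) ^+ 2) <= 4^-1 ^+ k)%R ->
  exists2 f, mu.-integrable D (EFin \o f) &
    (fun k => \int[mu]_(x in D) `|F k x - f x|)%R @ \oo --> (0 : R).
Proof.
move=> fD Fi Fi2 F4; apply: L1_complete => //.
have c0 : 0 <= fine (mu D) + 1 by rewrite addr_ge0// fine_ge0.
have half1 : `|2^-1| < 1 :> R by rewrite ger0_norm ?invf_lt1 ?ltr1n.
have bound k : (\int[mu]_(x in D) `|F k.+1 x - F k x|%:E <=
    (geometric (fine (mu D) + 1) 2^-1 k)%:E)%E.
  have di := integrable_EFinB (Fi k.+1) (Fi k).
  rewrite -EFin_Rintegral ?lee_fin; last exact: integrable_EFin_norm.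
  have e0 : 0 < 2^-1 ^+ k :> R by rewrite exprn_gt0 ?invr_gt0.
  have md : measurable_fun D (fun x => F k.+1 x - F k x).
    by apply/measurable_EFinP; exact: measurable_int di.
  apply: le_trans (Rintegral_norm_le_sqr e0 fD md (Fi2 k)) _.
  rewrite /geometric/= mulrDl mul1r mulrC lerD2l.
  apply: le_trans (ler_wpM2l _ (F4 k)) _; first by rewrite invr_ge0 ltW.
  rewrite -exprVn invrK -exprMn (_ : 2 * 4^-1 = 2^-1)//.
  by field.
apply: le_lt_trans (lee_nneseries (v := EFin \o geometric _ 2^-1) _ _) _.
- by move=> k _ _; apply: integral_ge0 => x _; rewrite lee_fin.
- by move=> k _; exact: bound.
apply: (@le_lt_trans _ _ ((fine (mu D) + 1) * (1 - 2^-1)^-1)%:E); last exact: ltry.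
apply: lime_le.
  by apply: is_cvg_nneseries => k _ _; rewrite lee_fin mulr_ge0 ?exprn_ge0 ?invr_ge0.
apply: nearW => m; rewrite sumEFin lee_fin.
by apply: geometric_le_lim; rewrite ?invr_gt0.
Qed.

End RealIntegral.

Lemma cvg_Rintegral_dist_subset d (T : measurableType d) (R : realType)
    (mu : {measure set T -> \bar R}) (D E : set T) (F : nat -> T -> R) (f : T -> R) :
  measurable D -> measurable E -> E `<=` D ->
  (forall k, mu.-integrable D (EFin \o F k)) -> mu.-integrable D (EFin \o f) ->
  (fun k => \int[mu]_(x in D) `|F k x - f x|)%R @ \oo --> (0 : R) ->
  (fun k => \int[mu]_(x in E) `|F k x - f x|)%R @ \oo --> (0 : R).
Proof.
move=> mD mE ED Fi fi; apply: squeeze_norm_cvg0 => k.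
have iD : mu.-integrable D (EFin \o (fun x => `|F k x - f x|)).
  by apply: integrable_EFin_norm => //; exact: integrable_EFinB.
have iE : mu.-integrable E (EFin \o (fun x => `|F k x - f x|)) by exact: integrableS iD.
rewrite ger0_norm; last by apply: Rintegral_ge0.
rewrite -lee_fin !EFin_Rintegral//; apply: ge0_subset_integral => //.
exact: measurable_int iD.
Qed.

(** * Trigonometric polynomials *)

Section ComplexModulus.
Context {R : realType}.
Local Notation C := R[i].
Implicit Types (z w : C) (x : R).

Lemma normr_cmod z : `|z| = (cmod z)%:C%C.
Proof. exact: normc_def. Qed.

Lemma cmod_ge0 z : 0 <= cmod z. Proof. exact: sqrtr_ge0. Qed.

Lemma cmod_sqr z : cmod z ^+ 2 = complex.Re z ^+ 2 + complex.Im z ^+ 2.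
Proof. by rewrite sqr_sqrtr ?addr_ge0 ?sqr_ge0. Qed.

Lemma cmodM z w : cmod (z * w) = cmod z * cmod w.
Proof. by apply: complexI; rewrite rmorphM /= -!normr_cmod normrM. Qed.

Lemma cmodX z k : cmod (z ^+ k) = cmod z ^+ k.
Proof. by apply: complexI; rewrite rmorphXn /= -!normr_cmod normrX. Qed.

Lemma cmod_conj z : cmod (Num.conj z) = cmod z.
Proof. by apply: complexI; rewrite -!normr_cmod norm_conjC. Qed.

Lemma cmodN z : cmod (- z) = cmod z.
Proof. by apply: complexI; rewrite -!normr_cmod normrN. Qed.

Lemma cmodD z w : cmod (z + w) <= cmod z + cmod w.
Proof. by rewrite -lecR rmorphD /= -!normr_cmod ler_normD. Qed.

Lemma cmod_sum n (F : nat -> C) : cmod (\sum_(k < n) F k) <= \sum_(k < n) cmod (F k).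
Proof.
rewrite -lecR -normr_cmod rmorph_sum /=; apply: le_trans (ler_norm_sum _ _ _) _.
by apply: ler_sum => k _; rewrite normr_cmod.
Qed.

Lemma cmod0 : cmod (0 : C) = 0.
Proof. by apply: complexI; rewrite -normr_cmod normr0. Qed.

Lemma cmod1 : cmod (1 : C) = 1.
Proof. by apply: complexI; rewrite -normr_cmod normr1. Qed.

Lemma cmod_eq0 z : (cmod z == 0) = (z == 0).
Proof. by rewrite -(inj_eq (@complexI R)) -normr_cmod normr_eq0. Qed.

Lemma mul_conj_cmod z : z * Num.conj z = (cmod z ^+ 2)%:C%C.
Proof. by rewrite rmorphXn /= -normr_cmod normCK. Qed.

Lemma Re_realM x z : complex.Re (x%:C%C * z) = x * complex.Re z.
Proof. by case: z => a b /=; rewrite mul0r subr0. Qed.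

Lemma Im_Re z : complex.Im z = complex.Re (- 'i%C * z).
Proof. by case: z => a b /=; rewrite oppr0 mul0r sub0r mulN1r opprK. Qed.

Lemma complex_Re_conj z : complex.Re (Num.conj z) = complex.Re z.
Proof. by case: z. Qed.

Lemma Re_norm_le z : `|complex.Re z| <= cmod z.
Proof. by rewrite -lecR -normr_cmod normc_ge_Re. Qed.

Lemma Im_norm_le z : `|complex.Im z| <= cmod z.
Proof.
rewrite -ler_sqr ?nnegrE ?cmod_ge0// real_normK ?num_real// cmod_sqr.
by rewrite lerDr sqr_ge0.
Qed.

Lemma cmod_le_Re_Im z : cmod z <= `|complex.Re z| + `|complex.Im z|.
Proof.
rewrite -(@ler_sqr _ (cmod z)) ?nnegrE ?cmod_ge0 ?addr_ge0// cmod_sqr.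
rewrite -(real_normK (num_real (complex.Re z))) -(real_normK (num_real (complex.Im z))).
by rewrite sqrrD lerD2r lerDl mulrn_wge0// mulr_ge0.
Qed.

Lemma cmod_sqrD z w : cmod (z + w) ^+ 2 =
  cmod z ^+ 2 + cmod w ^+ 2 + 2 * complex.Re (Num.conj z * w).
Proof. by rewrite !cmod_sqr; case: z w => [a b] [c d] /=; ring. Qed.

Lemma cmod_sqrD_le z w : cmod (z + w) ^+ 2 <= 2 * cmod z ^+ 2 + 2 * cmod w ^+ 2.
Proof.
have := sqr_ge0 (cmod (z - w)); rewrite !cmod_sqr.
by case: z w => [a b] [c d] /=; lra.
Qed.

Lemma complex_ext z w : complex.Re z = complex.Re w ->
  complex.Im z = complex.Im w -> z = w.
Proof. by case: z w => [a b] [c d] /= -> ->. Qed.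

Definition polar (r t : R) : C := Complex (r * cos t) (r * sin t).

Lemma polarM r s t u : polar r t * polar s u = polar (r * s) (t + u).
Proof. by apply: complex_ext; rewrite /= ?cosD ?sinD; ring. Qed.

Lemma polarX r t k : polar r t ^+ k = polar (r ^+ k) (k%:R * t).
Proof.
elim: k => [|k IH]; first by rewrite /polar mul0r cos0 sin0 mulr1 mulr0.
by rewrite exprS IH polarM -exprS -[in k.+1%:R]add1n natrD mulrDl mul1r.
Qed.

Lemma cmod_polar_sqr r t : cmod (polar r t) ^+ 2 = r ^+ 2.
Proof. by rewrite cmod_sqr /= !exprMn -mulrDr cos2Dsin2 mulr1. Qed.

Lemma cmod_polar r t : 0 <= r -> cmod (polar r t) = r.
Proof.
by move=> r0; apply/eqP; rewrite -(@eqrXn2 _ 2) ?cmod_ge0// cmod_polar_sqr.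
Qed.

Lemma conj_polarM r t : Num.conj (polar r t) * polar r t = (r ^+ 2)%:C%C.
Proof. by rewrite mulrC mul_conj_cmod cmod_polar_sqr. Qed.

Lemma polar_1r r t : polar r t = r%:C%C * polar 1 t.
Proof. by apply: complex_ext; rewrite /= ?mul1r ?mul0r ?subr0 ?addr0. Qed.

Definition taylor (c : nat -> C) (N : nat) z : C := \sum_(k < N) c k * z ^+ k.

Lemma taylorS c N z : taylor c N.+1 z = taylor c N z + c N * z ^+ N.
Proof. exact: big_ord_recr. Qed.

Lemma sum_cmod_cutoff (a : nat -> C) M N : (M <= N)%N ->
  \sum_(k < N) cmod (cutoff M a k) ^+ 2 =
  \sum_(k < N) cmod (a k) ^+ 2 - \sum_(k < M) cmod (a k) ^+ 2.
Proof.
move=> MN; rewrite -(sum_cutoff (fun k => cmod (a k) ^+ 2) MN).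
by apply: eq_bigr => k _; rewrite /cutoff; case: ifP => // _; rewrite cmod0 expr0n.
Qed.

Lemma taylor_cutoff c M N z : (M <= N)%N ->
  taylor (cutoff M c) N z = taylor c N z - taylor c M z.
Proof.
move=> MN; rewrite /taylor -(sum_cutoff (fun k => c k * z ^+ k) MN).
by apply: eq_bigr => k _; rewrite /cutoff; case: ifP => // _; rewrite mul0r.
Qed.

Lemma taylorZ a c N z : taylor (fun k => a * c k) N z = a * taylor c N z.
Proof. by rewrite /taylor mulr_sumr; under eq_bigr do rewrite -mulrA. Qed.

Lemma cmod_taylor_le c N z : cmod (taylor c N z) <= \sum_(k < N) cmod (c k) * cmod z ^+ k.
Proof.
apply: le_trans (cmod_sum N (fun k => c k * z ^+ k)) _.
by under eq_bigr do rewrite cmodM cmodX.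
Qed.

End ComplexModulus.

Section SquareSummable.
Context {R : realType}.
Implicit Types c : nat -> R[i].

Definition sqsum c : R := limn (series (fun k => cmod (c k) ^+ 2)).

Definition sqtail c N : R := sqsum c - \sum_(k < N) cmod (c k) ^+ 2.

Lemma is_H2_sqsum_le c (B : R) : (forall N, \sum_(k < N) cmod (c k) ^+ 2 <= B) ->
  is_H2 c /\ sqsum c <= B.
Proof.
move=> cB; have c_H2 : is_H2 c.
  apply: nondecreasing_is_cvgn.
    by apply: nondecreasing_series => k _ _; rewrite sqr_ge0.
  by exists B => _ [N _ <-]; rewrite seriesEord; exact: cB.
split=> //; apply: limr_le => //; apply: nearW => N; rewrite seriesEord.
exact: cB.
Qed.

Lemma sum_le_sqsum c N : is_H2 c -> \sum_(k < N) cmod (c k) ^+ 2 <= sqsum c.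
Proof.
move=> c_H2; have -> : \sum_(k < N) cmod (c k) ^+ 2 = series (fun k => cmod (c k) ^+ 2) N.
  by rewrite seriesEord.
apply: nondecreasing_cvgn_le c_H2 _.
by apply: nondecreasing_series => k _ _; rewrite sqr_ge0.
Qed.

Lemma sqsum_cvg c : is_H2 c ->
  (fun N => \sum_(k < N) cmod (c k) ^+ 2) @ \oo --> sqsum c.
Proof.
move=> c_H2; rewrite (_ : (fun N => _) = series (fun k => cmod (c k) ^+ 2))//.
by apply/funext => N; rewrite seriesEord.
Qed.

Lemma sqtail_cvg0 c : is_H2 c -> sqtail c @ \oo --> (0 : R).
Proof.
move=> c_H2; rewrite -[X in _ --> X](subrr (sqsum c)).
by apply: cvgB; [exact: cvg_cst|exact: sqsum_cvg].
Qed.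

Lemma cmod_sqr_le_sqsum c k : is_H2 c -> cmod (c k) ^+ 2 <= sqsum c.
Proof.
move=> /(sum_le_sqsum k.+1); apply: le_trans.
by rewrite big_ord_recr/= lerDr sumr_ge0// => i _; rewrite sqr_ge0.
Qed.

Lemma cmod_taylor_H2_le c N (z : R[i]) : is_H2 c -> cmod z < 1 ->
  cmod (taylor c N z) <= (1 + sqsum c) / (1 - cmod z).
Proof.
move=> c_H2 z1; have coef_le k : cmod (c k) <= 1 + sqsum c.
  apply: le_trans (lerD (lexx _) (cmod_sqr_le_sqsum k c_H2)).
  by have := sqr_ge0 (cmod (c k)); nra.
apply: le_trans (cmod_taylor_le _ _ _) _.
apply: (@le_trans _ _ (\sum_(k < N) (1 + sqsum c) * cmod z ^+ k)).
  by apply: ler_sum => k _; rewrite ler_wpM2r ?exprn_ge0 ?cmod_ge0.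
have bound_ge0 : 0 <= 1 + sqsum c by apply: le_trans (coef_le 0%N); exact: cmod_ge0.
rewrite -mulr_sumr ler_wpM2l// -[(1 - cmod z)^-1]mul1r ler_pdivlMr ?subr_gt0//.
by rewrite mulrC -opprB mulNr -subrX1 opprB gerBl exprn_ge0 ?cmod_ge0.
Qed.

End SquareSummable.

Section Turns.
Context {R : realType}.
Local Notation mu := (@lebesgue_measure R).
Local Notation C := R[i].
Implicit Types (r t x : R) (m : nat) (a : C) (c : nat -> C).

Definition turns x m : set R := `[x, x + pi *+ 2 *+ m].

Lemma measurable_turns x m : measurable (turns x m : set (measurableTypeR R)).
Proof. exact: measurable_itv. Qed.

Lemma turns_length_ge0 m : 0 <= pi *+ 2 *+ m :> R.
Proof. by do 2!apply: mulrn_wge0; exact: pi_ge0. Qed.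

Lemma lebesgue_measure_turns x m : mu (turns x m) = (pi *+ 2 *+ m)%:E.
Proof.
rewrite /turns lebesgue_measure_itv/= lte_fin ltrDl; case: ltP => [_|turns_le0].
  by rewrite -EFinD addrAC subrr add0r.
by congr EFin; apply/le_anti; rewrite turns_le0 turns_length_ge0.
Qed.

Lemma continuous_integrable_turns (f : R -> R) x m :
  continuous f -> mu.-integrable (turns x m) (EFin \o f).
Proof.
move=> cf; apply: continuous_compact_integrable; first exact: segment_compact.
exact: continuous_subspaceT.
Qed.

Lemma Rintegral_turns_cst x m (k : R) :
  (\int[mu]_(t in turns x m) k = k * (pi *+ 2 *+ m))%R.
Proof.
rewrite Rintegral_cst; last exact: measurable_turns.
by rewrite /= lebesgue_measure_turns.
Qed.

Lemma continuous_cosM k : continuous (fun t : R => cos (k * t)).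
Proof.
by move=> t; apply: continuous_comp; [exact: mulrl_continuous|exact: continuous_cos].
Qed.

Lemma continuous_sinM k : continuous (fun t : R => sin (k * t)).
Proof.
by move=> t; apply: continuous_comp; [exact: mulrl_continuous|exact: continuous_sin].
Qed.

Lemma Re_polarX a r t k : complex.Re (a * polar r t ^+ k) =
  r ^+ k * (complex.Re a * cos (k%:R * t) - complex.Im a * sin (k%:R * t)).
Proof. by rewrite polarX; case: a => a b /=; ring. Qed.

Lemma continuous_Re_polarX a r k :
  continuous (fun t : R => complex.Re (a * polar r t ^+ k)).
Proof.
under eq_fun do rewrite Re_polarX.
move=> t; apply: cvgM; first exact: cvg_cst.
apply: cvgB; apply: cvgM; do ?exact: cvg_cst.
- exact: continuous_cosM.
- exact: continuous_sinM.
Qed.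

Lemma continuous_Re_taylor c r N :
  continuous (fun t : R => complex.Re (taylor c N (polar r t))).
Proof.
elim: N => [|N IH] t.
  by under eq_fun do rewrite /taylor big_ord0; exact: cvg_cst.
under eq_fun do rewrite taylorS raddfD/=.
by apply: cvgD; [exact: IH|exact: continuous_Re_polarX].
Qed.

Lemma continuous_Im_taylor c r N :
  continuous (fun t : R => complex.Im (taylor c N (polar r t))).
Proof.
under eq_fun do rewrite Im_Re -taylorZ.
exact: continuous_Re_taylor.
Qed.

Lemma continuous_cmod_taylor_sqr c r N :
  continuous (fun t : R => cmod (taylor c N (polar r t)) ^+ 2).
Proof.
under eq_fun do rewrite cmod_sqr !expr2.
move=> t; apply: cvgD; apply: cvgM.
- exact: continuous_Re_taylor.
- exact: continuous_Re_taylor.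
- exact: continuous_Im_taylor.
- exact: continuous_Im_taylor.
Qed.

Lemma Rintegral_FTC (f F : R -> R) x y : x <= y -> continuous f ->
  (forall t : R, is_derive t 1 F (f t)) ->
  (\int[mu]_(t in `[x, y]) f t = F y - F x)%R.
Proof.
rewrite le_eqVlt => /predU1P[-> _ _|xy cf dF].
  by rewrite set_itv1 Rintegral_set1 subrr.
have cF : continuous F.
  by move=> t; apply/differentiable_continuous/derivable1_diffP; have [] := dF t.
rewrite /Rintegral (@continuous_FTC2 _ f F)//.
- exact: continuous_subspaceT.
- split; first by move=> t _; have [] := dF t.
  + exact/cvg_at_right_filter/cF.
  + exact/cvg_at_left_filter/cF.
- by move=> t _; rewrite derive1E; have [_ ->] := dF t.
Qed.

Lemma Rintegral_Re_polarX a r x m k : (0 < k)%N ->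
  (\int[mu]_(t in turns x m) complex.Re (a * polar r t ^+ k) = 0)%R.
Proof.
move=> k0; have k_neq0 : k%:R != 0 :> R by rewrite pnatr_eq0 -lt0n.
pose F t := r ^+ k / k%:R *
  (complex.Re a * sin (k%:R * t) + complex.Im a * cos (k%:R * t)).
have dF (t : R) : is_derive t 1 F (complex.Re (a * polar r t ^+ k)).
  by rewrite Re_polarX; apply: is_derive_eq; rewrite /GRing.scale/=; field.
rewrite /turns (Rintegral_FTC _ _ dF); first last.
- exact: continuous_Re_polarX.
- by rewrite lerDl turns_length_ge0.
have -> : F (x + pi *+ 2 *+ m) = F x; last by rewrite subrr.
rewrite /F (_ : k%:R * _ = k%:R * x + pi *+ 2 *+ (k * m)).
  by rewrite (periodicn (@sinD2pi R)) (periodicn (@cosD2pi R)).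
by rewrite mulrDr; congr (_ + _); rewrite mulr_natl -mulrnA mulnC.
Qed.

Lemma taylor_cross_term c r t N :
  Num.conj (taylor c N (polar r t)) * (c N * polar r t ^+ N) =
  \sum_(k < N) (Num.conj (c k) * c N * (r ^+ (2 * k))%:C%C) * polar r t ^+ (N - k).
Proof.
rewrite /taylor rmorph_sum mulr_suml; apply: eq_bigr => k _.
have -> : polar r t ^+ N = polar r t ^+ k * polar r t ^+ (N - k).
  by rewrite -exprD subnKC// ltnW.
rewrite rmorphM rmorphXn /= exprM rmorphXn /= -(conj_polarM r t) exprMn.
by ring.
Qed.

Lemma parseval c r x m N :
  (\int[mu]_(t in turns x m) (cmod (taylor c N (polar r t)) ^+ 2) =
   (pi *+ 2 *+ m) * \sum_(k < N) cmod (c k) ^+ 2 * r ^+ (2 * k))%R.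
Proof.
have mD := measurable_turns x m.
elim: N => [|N IH].
  under eq_Rintegral do rewrite /taylor big_ord0 cmod0 expr0n.
  by rewrite Rintegral_turns_cst mul0r big_ord0 mulr0.
pose cross t := complex.Re (Num.conj (taylor c N (polar r t)) * (c N * polar r t ^+ N)).
pose term (k : nat) t := complex.Re
  ((Num.conj (c k) * c N * (r ^+ (2 * k))%:C%C) * polar r t ^+ (N - k)).
have term_i k : mu.-integrable (turns x m) (EFin \o term k).
  by apply: continuous_integrable_turns; exact: continuous_Re_polarX.
have crossE : cross = (fun t => \sum_(k < N) term k t).
  by apply/funext => t; rewrite /cross taylor_cross_term raddf_sum.
have cross_i : mu.-integrable (turns x m) (EFin \o cross).
  by rewrite crossE; exact: integrable_EFin_sum.
have int_cross : (\int[mu]_(t in turns x m) cross t = 0)%R.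
  rewrite crossE Rintegral_sum// big1// => k _.
  by rewrite Rintegral_Re_polarX// subn_gt0.
have lead_i : mu.-integrable (turns x m) (EFin \o (fun=> cmod (c N) ^+ 2 * r ^+ (2 * N))).
  by apply: continuous_integrable_turns => t; exact: cvg_cst.
transitivity (\int[mu]_(t in turns x m) (cmod (taylor c N (polar r t)) ^+ 2 +
    cmod (c N) ^+ 2 * r ^+ (2 * N) + 2 * cross t))%R.
  apply: eq_Rintegral => t _; rewrite taylorS cmod_sqrD cmodM exprMn; congr (_ + _ * _ + _).
  by rewrite cmodX -exprM mulnC exprM cmod_polar_sqr exprM.
have square_i := continuous_integrable_turns x m (@continuous_cmod_taylor_sqr c r N).
rewrite RintegralD//; [|exact: integrable_EFinD|exact: integrable_EFinZ].
rewrite RintegralD// [X in _ + X]RintegralZl// int_cross mulr0 addr0 IH Rintegral_turns_cst.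
by rewrite big_ord_recr/= mulrDr [_ * (pi *+ _ *+ _)]mulrC.
Qed.

End Turns.

(** * The Poisson kernel *)

Section Poisson.
Context {R : realType}.
Local Notation mu := (@lebesgue_measure R).
Local Notation C := R[i].
Implicit Types (r s t x y : R) (a : C) (c : nat -> C).

Definition poisson_den r s : R := 1 - 2 * r * cos s + r ^+ 2.

Definition poisson r s : R := (1 - r ^+ 2) / poisson_den r s.

Lemma poisson_denE r s : poisson_den r s = (1 - r) ^+ 2 + 2 * r * (1 - cos s).
Proof. by rewrite /poisson_den; ring. Qed.

Lemma poisson_den_gt0 r s : 0 <= r < 1 -> 0 < poisson_den r s.
Proof.
move=> /andP[r0 r1]; rewrite poisson_denE ltr_wpDr ?exprn_gt0 ?subr_gt0//.
by rewrite !mulr_ge0// subr_ge0 cos_le1.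
Qed.

Lemma poissonM_den r s : 0 <= r < 1 -> poisson r s * poisson_den r s = 1 - r ^+ 2.
Proof. by move=> r01; rewrite divfK// lt0r_neq0 ?poisson_den_gt0. Qed.

Lemma poisson_ge0 r s : 0 <= r < 1 -> 0 <= poisson r s.
Proof.
move=> r01; rewrite divr_ge0 ?(ltW (poisson_den_gt0 s r01))//.
by case/andP: r01 => r0 r1; rewrite subr_ge0 expr_le1// ltW.
Qed.

Lemma poissonM_le r s (m : R) : 0 <= r < 1 -> m <= poisson_den r s ->
  poisson r s * m <= 2 * (1 - r).
Proof.
move=> r01 /(ler_wpM2l (poisson_ge0 s r01))/le_trans; apply; rewrite poissonM_den//.
by rewrite -subr_ge0 (_ : _ - _ = (1 - r) ^+ 2) ?sqr_ge0//; ring.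
Qed.

Lemma poisson_le r s : 0 <= r < 1 -> poisson r s <= 2 / (1 - r).
Proof.
move=> r01; have r1 : 0 < 1 - r by case/andP: r01; rewrite subr_gt0.
have den_ge : (1 - r) ^+ 2 <= poisson_den r s.
  by case/andP: r01 => r0 _; rewrite poisson_denE lerDl !mulr_ge0// subr_ge0 cos_le1.
rewrite ler_pdivlMr// -(ler_pM2r r1) -mulrA -expr2.
exact: poissonM_le.
Qed.

Lemma norm_poisson_le r s : 0 <= r < 1 -> `|poisson r s| <= 2 / (1 - r).
Proof. by move=> r01; rewrite ger0_norm ?poisson_ge0 ?poisson_le. Qed.

Lemma mul_cos_le_sin x : 0 <= x <= pi -> x * cos x <= sin x.
Proof.
move=> /andP[]; rewrite le_eqVlt => /predU1P[<- _|x0 x_pi]; first by rewrite mul0r sin0.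
have [|z] := @MVT R sin cos 0 x x0 (fun z _ => is_derive_sin z).
  exact/continuous_subspaceT/continuous_sin.
rewrite in_itv/= sin0 !subr0 => /andP[z0 zx] ->; rewrite mulrC ler_wpM2r ?(ltW x0)//.
by rewrite ltW// ltr_cos// in_itv/= ?(ltW x0)//; apply/andP; split; lra.
Qed.

Lemma sin_ge_half x : 0 <= x <= pi / 2 -> x / 2 <= sin x.
Proof.
move=> /andP[x0 x_pi2]; have pi_pos := @pi_gt0 R.
pose y := x / 2; have xE : x = y *+ 2 by rewrite /y -mulr_natr; field.
have y0 : 0 <= y by rewrite divr_ge0.
have cos_y : 0 <= cos y by apply: cos_ge0_pihalf; apply/andP; split; lra.
have cos_x : 0 <= y * cos x.
  by rewrite mulr_ge0// cos_ge0_pihalf//; apply/andP; split; lra.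
have y_pi : 0 <= y <= pi by apply/andP; split; lra.
have cosE : cos x = 2 * cos y ^+ 2 - 1 by rewrite {1}xE cos_mulr2n; ring.
have sinE : sin x = 2 * (cos y * sin y) by rewrite {1}xE sin_mulr2n; ring.
have := ler_wpM2l cos_y (mul_cos_le_sin y_pi).
by rewrite cosE in cos_x; rewrite sinE -/y; nra.
Qed.

Lemma one_sub_cos_ge s : `|s| <= pi -> s ^+ 2 / 8 <= 1 - cos s.
Proof.
move=> s_pi; have /sin_ge_half sin_ge : 0 <= `|s| / 2 <= pi / 2.
  by rewrite divr_ge0//= ler_pM2r ?invr_gt0.
have -> : cos s = 1 - 2 * sin (`|s| / 2) ^+ 2.
  rewrite -cos_norm {1}(_ : `|s| = `|s| / 2 *+ 2); last by rewrite -mulr_natr; field.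
  by rewrite cos_mulr2n cos2sin2; ring.
rewrite -(real_normK (num_real s)); have := normr_ge0 s.
by move: sin_ge; set u := `|s|; set v := sin _; nra.
Qed.

Lemma poisson_sqr_le r s : 2^-1 <= r < 1 -> `|s| <= pi ->
  poisson r s * s ^+ 2 <= 16 * (1 - r).
Proof.
move=> /andP[r2 r1] s_pi; have r01 : 0 <= r < 1 by apply/andP; lra.
have sqr_le : s ^+ 2 / 8 <= poisson_den r s.
  apply: le_trans (one_sub_cos_ge s_pi) _; rewrite poisson_denE.
  have := sqr_ge0 (1 - r); have := cos_le1 s; nra.
by have := poissonM_le r01 sqr_le; lra.
Qed.

Lemma continuous_poisson r t : 0 <= r < 1 -> continuous (fun y => poisson r (y - t)).
Proof.
move=> r01 y; apply: cvgM; first exact: cvg_cst.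
apply: cvgV; first by rewrite lt0r_neq0// poisson_den_gt0.
apply: cvgD; last exact: cvg_cst.
apply: cvgB; first exact: cvg_cst.
apply: cvgM; first exact: cvg_cst.
apply: (@continuous_comp _ _ _ (fun y => y - t)); last exact: continuous_cos.
by apply: cvgB; [exact: cvg_id|exact: cvg_cst].
Qed.

Lemma measurable_poisson r t (D : set R) : measurable D -> 0 <= r < 1 ->
  measurable_fun D (fun y => poisson r (y - t)).
Proof.
move=> mD r01; apply: measurable_funTS; apply: continuous_measurable_fun.
exact: continuous_poisson.
Qed.

(* The characteristic roots are [r] and [1 / r]; boundedness excludes the second. *)
Lemma bounded_recurrence r (B : R) (u : nat -> R) : 0 <= r < 1 ->
  (forall k, `|u k| <= B) ->
  (forall k, (1 + r ^+ 2) * u k.+1 = r * (u k.+2 + u k)) ->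
  forall k, u k = r ^+ k * u 0%N.
Proof.
move=> /andP[r0 r1] uB rec; pose v k := u k.+1 - r * u k.
have vE m k : v k = r ^+ m * v (k + m)%N.
  elim: m => [|m ->]; first by rewrite mul1r addn0.
  rewrite exprSr -mulrA addnS; congr (_ * _).
  by have := rec (k + m)%N; rewrite /v; lra.
have v_le k : `|v k| <= B + B.
  rewrite (le_trans (ler_normB _ _))// lerD// normrM ger0_norm//.
  by rewrite (le_trans _ (uB k))// ler_piMl// ltW.
have v0 k : v k = 0.
  apply: (@cvg0_sqr_eq0 _ _ (fun m => (B + B) * (B + B) * r ^+ m)).
    apply: nearW => m; rewrite -(real_normK (num_real (v k))) expr2 -mulrA.
    rewrite ler_pM// (vE m k) normrM (ger0_norm (exprn_ge0 m r0)) mulrC.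
    by rewrite ler_wpM2r ?exprn_ge0.
  by apply: cvg_geometric; rewrite ger0_norm.
elim=> [|k IH]; first by rewrite mul1r.
by rewrite exprS -mulrA -IH; apply/eqP; rewrite -subr_eq0 -/(v k) v0.
Qed.

Section Reproducing.
Variables r t : R.
Hypothesis r01 : 0 <= r < 1.

Local Notation window := (turns (t - pi) 1).

Let wave a k y : R := complex.Re (a * polar 1 (y - t) ^+ k).

Let wave_polarX a k :
  wave a k = fun y => complex.Re (a * polar 1 (- t) ^+ k * polar 1 y ^+ k).
Proof.
by apply/funext => y; rewrite /wave -mulrA -exprMn polarM mulr1 addrC.
Qed.

Let wave_rec a k y : wave a k.+2 y + wave a k y = 2 * cos (y - t) * wave a k.+1 y.
Proof.
set p := polar 1 (y - t).
have sqr_p : p ^+ 2 + 1 = (2 * cos (y - t))%:C%C * p.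
  by rewrite expr2; apply: complex_ext => /=; have := cos2Dsin2 (y - t); lra.
rewrite /wave -raddfD/= -mulrDr -Re_realM mulrCA; congr (complex.Re (_ * _)).
by rewrite 2!exprSr [RHS]mulrCA -sqr_p mulrDr mulr1 expr2 mulrA.
Qed.

Let continuous_wave a k : continuous (wave a k).
Proof.
rewrite wave_polarX.
exact: continuous_Re_polarX.
Qed.

Let moment a k := (\int[mu]_(y in window) (poisson r (y - t) * wave a k y))%R.

Let moment_integrable a k :
  mu.-integrable window (EFin \o (fun y => poisson r (y - t) * wave a k y)).
Proof.
apply: continuous_integrable_turns => y; apply: cvgM.
- exact: continuous_poisson.
- exact: continuous_wave.
Qed.

Let Rintegral_wave a k : (0 < k)%N -> (\int[mu]_(y in window) wave a k y = 0)%R.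
Proof. by move=> k0; rewrite wave_polarX; exact: Rintegral_Re_polarX. Qed.

Let moment_rec a k : (1 + r ^+ 2) * moment a k.+1 = r * (moment a k.+2 + moment a k).
Proof.
have mD := @measurable_turns R (t - pi) 1.
have sum_i := integrable_EFinD mD (moment_integrable a k.+2) (moment_integrable a k).
rewrite /moment -RintegralD// -!RintegralZl//; apply/eqP; rewrite -subr_eq0.
rewrite -RintegralB//; [|exact: integrable_EFinZ|exact: integrable_EFinZ].
apply/eqP; transitivity (\int[mu]_(y in window) ((1 - r ^+ 2) * wave a k.+1 y))%R.
  apply: eq_Rintegral => y _; rewrite -mulrDr wave_rec -(poissonM_den (y - t) r01).
  by rewrite /poisson_den; ring.
rewrite RintegralZl ?Rintegral_wave ?mulr0//.
exact/continuous_integrable_turns/continuous_wave.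
Qed.

Let moment_le a k : `|moment a k| <= 2 / (1 - r) * cmod a * (pi *+ 2).
Proof.
have mD := @measurable_turns R (t - pi) 1.
apply: le_trans (le_normr_Rintegral mD (moment_integrable a k)) _.
rewrite -[leRHS](@Rintegral_turns_cst _ (t - pi) 1); apply: le_Rintegral => //.
- exact: integrable_EFin_norm.
- by apply: continuous_integrable_turns => y; exact: cvg_cst.
move=> y _; rewrite normrM ler_pM ?norm_poisson_le//.
by rewrite (le_trans (Re_norm_le _))// cmodM cmodX cmod_polar// expr1n mulr1.
Qed.

Let momentE a k : moment a k = r ^+ k * moment a 0.
Proof. exact: bounded_recurrence (moment_le a) (moment_rec a) k. Qed.

Lemma Rintegral_poisson : (\int[mu]_(y in window) poisson r (y - t) = pi *+ 2)%R.
Proof.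
have mD := @measurable_turns R (t - pi) 1.
have poissonE : (\int[mu]_(y in window) poisson r (y - t))%R = moment 1 0.
  by apply: eq_Rintegral => y _; rewrite /wave mul1r mulr1.
have den_int : (1 + r ^+ 2) * moment 1 0 - 2 * r * moment 1 1 = (1 - r ^+ 2) * (pi *+ 2).
  rewrite -[RHS](@Rintegral_turns_cst _ (t - pi) 1) /moment -!RintegralZl//.
  rewrite -RintegralB//; [|exact: integrable_EFinZ|exact: integrable_EFinZ].
  apply: eq_Rintegral => y _; rewrite -(poissonM_den (y - t) r01) /wave /poisson_den.
  by rewrite !mul1r expr0 expr1 /=; ring.
have r2 : 1 - r ^+ 2 != 0.
  by case/andP: r01 => r0 r1; rewrite lt0r_neq0// subr_gt0 expr_lt1.
by rewrite poissonE; apply: (mulfI r2); rewrite -den_int (momentE 1 1) expr1; ring.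
Qed.

Lemma poisson_Re_polarX a k :
  (\int[mu]_(y in window) (poisson r (y - t) * complex.Re (a * polar 1 y ^+ k)) =
   (pi *+ 2) * complex.Re (a * polar r t ^+ k))%R.
Proof.
have cp := continuous_integrable_turns (t - pi) 1 (@continuous_poisson _ t r01).
pose b := a * polar 1 t ^+ k.
transitivity (moment b k).
  apply: eq_Rintegral => y _; rewrite /wave /b -[in RHS]mulrA -exprMn polarM mulr1.
  by rewrite subrKC.
rewrite momentE; transitivity (r ^+ k * (complex.Re b * (pi *+ 2))); last first.
  have -> : a * polar r t ^+ k = (r ^+ k)%:C%C * b.
    by rewrite (polar_1r r) exprMn rmorphXn/= mulrCA.
  by rewrite Re_realM; ring.
congr (_ * _); rewrite -Rintegral_poisson -RintegralZl//; last exact: measurable_turns.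
by apply: eq_Rintegral => y _; rewrite /wave mulr1 mulrC.
Qed.

Lemma poisson_Re_taylor c N :
  (\int[mu]_(y in window) (poisson r (y - t) * complex.Re (taylor c N (polar 1 y))) =
   (pi *+ 2) * complex.Re (taylor c N (polar r t)))%R.
Proof.
pose term k y := poisson r (y - t) * complex.Re (c k * polar 1 y ^+ k).
transitivity (\int[mu]_(y in window) (\sum_(k < N) term k y))%R.
  by apply: eq_Rintegral => y _; rewrite /taylor raddf_sum mulr_sumr.
rewrite Rintegral_sum; first last.
- move=> k; apply: continuous_integrable_turns => y; apply: cvgM.
  + exact: continuous_poisson.
  + exact: continuous_Re_polarX.
- exact: measurable_turns.
rewrite /taylor raddf_sum mulr_sumr; apply: eq_bigr => k _.
exact: poisson_Re_polarX.
Qed.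

End Reproducing.

End Poisson.

(** * Poisson integrals at Lebesgue points *)

Section NonnegativeIntegral.
Context d (T : measurableType d) (R : realType) (mu : {measure set T -> \bar R}).

Lemma ge0_integral_setD (A B : set T) (f : T -> \bar R) :
  measurable A -> measurable B -> A `<=` B -> measurable_fun B f ->
  (forall x, B x -> (0 <= f x)%E) ->
  (\int[mu]_(x in B) f x = \int[mu]_(x in A) f x + \int[mu]_(x in B `\` A) f x)%E.
Proof.
move=> mA mB AB mf f0; rewrite -{1}(setDUK AB) ge0_integral_setU ?setDUK//.
- exact: measurableD.
- by apply/disj_setPS => x [Ax []].
Qed.

Lemma ge0_integralM_le (D : set T) (c : R) (K g : T -> R) : measurable D ->
  measurable_fun D K -> measurable_fun D g -> (forall x, D x -> 0 <= g x) ->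
  0 <= c -> (forall x, D x -> 0 <= K x <= c) ->
  (\int[mu]_(x in D) (K x * g x)%:E <= c%:E * \int[mu]_(x in D) (g x)%:E)%E.
Proof.
move=> mD mK mg g0 c0 Kc; have mgE := (measurable_EFinP _ _).2 mg.
rewrite -ge0_integralZl_EFin//; apply: ge0_le_integral => //.
- by move=> x Dx; rewrite lee_fin mulr_ge0 ?g0//; case/andP: (Kc x Dx).
- exact/measurable_EFinP/measurable_funM.
- exact: measurable_funeM.
- by move=> x Dx; rewrite -EFinM lee_fin ler_wpM2r ?g0//; case/andP: (Kc x Dx).
Qed.

End NonnegativeIntegral.

Section ApproximateIdentity.
Context {R : realType}.
Local Notation mu := (@lebesgue_measure R).

Lemma dyadic_bracket (e d : R) : 0 < e -> e <= d ->
  exists J, 2 ^+ J * e <= d < 2 ^+ J.+1 * e.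
Proof.
move=> e0 ed; have exJ : exists J, d < 2 ^+ J * e.
  exists (Num.bound (d / e)); rewrite -ltr_pdivrMr//.
  apply: lt_le_trans (archi_boundP _) _; first by rewrite divr_ge0 ?(le_trans _ ed) ?ltW.
  by rewrite -natrX ler_nat ltnW// ltn_expl.
have [[|J] dJ minJ] := ex_minnP exJ; first by move: dJ; rewrite mul1r ltNge ed.
exists J; rewrite dJ andbT leNgt; apply/negP => /minJ; by rewrite ltnn.
Qed.

Variables (t eta delta eps A B : R) (I : set (measurableTypeR R)) (g K : R -> R).
Hypotheses (eta_gt0 : 0 < eta) (eps_ge0 : 0 <= eps) (A_ge0 : 0 <= A) (B_ge0 : 0 <= B).
Hypotheses (mI : measurable I) (mg : measurable_fun I g) (mK : measurable_fun I K).
Hypotheses (g_ge0 : forall y, I y -> 0 <= g y) (K_ge0 : forall y, I y -> 0 <= K y).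
Hypothesis K_le : forall y, I y -> K y <= A / eta.
Hypothesis K_sqr_le : forall y, I y -> K y * (y - t) ^+ 2 <= B * eta.
Hypothesis ball_sub : ball t delta `<=` I.
Hypothesis g_mean_le : forall h : R, 0 < h -> h <= delta ->
  (\int[mu]_(y in ball t h) (g y)%:E <= (eps * 2 * h)%:E)%E.

Let ball_subI h : h <= delta -> ball t h `<=` I.
Proof. by move=> hd; apply: subset_trans ball_sub; exact: le_ball. Qed.

Let integralM_outside_ball (D : set (measurableTypeR R)) (h : R) :
  measurable D -> D `<=` I -> 0 < h -> (forall y, D y -> ~ ball t h y) ->
  (\int[mu]_(y in D) (K y * g y)%:E <=
     (B * eta / h ^+ 2)%:E * \int[mu]_(y in D) (g y)%:E)%E.
Proof.
move=> mD DI h0 Dh.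
apply: ge0_integralM_le => //.
- exact: measurable_funS mK.
- exact: measurable_funS mg.
- by move=> y /DI; exact: g_ge0.
- by rewrite divr_ge0 ?sqr_ge0// mulr_ge0// ltW.
move=> y Dy; have Iy := DI y Dy; rewrite K_ge0//= ler_pdivlMr ?exprn_gt0//.
apply: le_trans (K_sqr_le Iy); rewrite ler_wpM2l ?K_ge0//.
have := Dh y Dy; rewrite -ball_normE/= distrC => /negP; rewrite -leNgt => hy.
by rewrite -(real_normK (num_real (y - t))) lerXn2r ?nnegrE ?(ltW h0).
Qed.

Let measurable_ballR e : measurable (ball t e : set (measurableTypeR R)).
Proof. exact: measurable_ball. Qed.

Let integralM_core : eta <= delta ->
  (\int[mu]_(y in ball t eta) (K y * g y)%:E <= (eps * (2 * A))%:E)%E.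
Proof.
move=> eta_delta; have ball_I := ball_subI eta_delta.
have mb := measurable_ballR eta.
apply: le_trans (@ge0_integralM_le _ _ R mu _ (A / eta) K g mb _ _ _ _ _) _.
- exact: measurable_funS mK.
- exact: measurable_funS mg.
- by move=> y /ball_I; exact: g_ge0.
- by rewrite divr_ge0// ltW.
- by move=> y /ball_I Iy; rewrite K_ge0//= K_le.
apply: le_trans (lee_wpmul2l _ (g_mean_le eta_gt0 eta_delta)) _.
  by rewrite lee_fin divr_ge0// ltW.
rewrite -EFinM lee_fin le_eqVlt; apply/orP; left.
by apply/eqP; field; rewrite lt0r_neq0.
Qed.

Let integralM_shell h : 0 < h -> 2 * h <= delta ->
  (\int[mu]_(y in ball t (2 * h) `\` ball t h) (K y * g y)%:E <=
    (4 * B * eps * (eta / h))%:E)%E.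
Proof.
move=> h0 hd; have ball_I := ball_subI hd.
apply: le_trans (integralM_outside_ball (measurableD _ _) _ h0 _) _ => //.
- by move=> y [/ball_I].
- by move=> y [].
rewrite (_ : 4 * B * eps * (eta / h) = B * eta / h ^+ 2 * (eps * 2 * (2 * h))); last first.
  by field; rewrite lt0r_neq0.
rewrite [leRHS]EFinM lee_wpmul2l ?lee_fin ?divr_ge0 ?sqr_ge0 ?mulr_ge0 ?(ltW eta_gt0)//.
apply: le_trans (g_mean_le _ hd); last by rewrite mulr_gt0.
apply: ge0_subset_integral => //.
- exact: measurableD.
- by apply/measurable_EFinP; exact: measurable_funS mI ball_I mg.
- by move=> y /ball_I; rewrite lee_fin; exact: g_ge0.
Qed.

Let integralM_ball J : 2 ^+ J * eta <= delta ->
  (\int[mu]_(y in ball t (2 ^+ J * eta)) (K y * g y)%:E <=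
     (eps * (2 * A + 8 * B * (1 - (2 ^+ J)^-1)))%:E)%E.
Proof.
elim: J => [|J IH] Jd.
  rewrite mul1r in Jd *; apply: le_trans (integralM_core Jd) _.
  by rewrite expr0 invr1 subrr mulr0 addr0.
set h := 2 ^+ J * eta; have hE : 2 ^+ J.+1 * eta = 2 * h by rewrite exprS -mulrA.
rewrite hE in Jd *; have p0 : 0 < 2 ^+ J :> R by rewrite exprn_gt0.
have h0 : 0 < h by rewrite mulr_gt0.
have hd : h <= delta by lra.
rewrite (@ge0_integral_setD _ _ R mu (ball t h))//; first last.
- by move=> y /(ball_subI Jd) Iy; rewrite lee_fin mulr_ge0 ?K_ge0 ?g_ge0.
- apply/measurable_EFinP; apply: measurable_funS mI (ball_subI Jd) _.
  exact: measurable_funM.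
- by apply: le_ball; lra.
apply: le_trans (leeD (IH hd) (integralM_shell h0 Jd)) _.
rewrite -EFinD lee_fin le_eqVlt; apply/orP; left; apply/eqP.
rewrite (exprS _ J) /h; move: p0; set p := 2 ^+ J => p0; field.
by rewrite !lt0r_neq0.
Qed.

(* Split [I] into the core [|y - t| < eta], dyadic shells out to a radius at least
   [delta / 2], whose contributions decrease geometrically, and the rest. *)
Lemma approximate_identity_le : eta <= delta ->
  (\int[mu]_(y in I) (K y * g y)%:E <= (eps * (2 * A + 8 * B))%:E +
     (4 * B * eta / delta ^+ 2)%:E * \int[mu]_(y in I) (g y)%:E)%E.
Proof.
move=> eta_delta; have [J /andP[Jd dJ]] := dyadic_bracket eta_gt0 eta_delta.
have d0 : 0 < delta by exact: lt_le_trans eta_delta.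
set h := 2 ^+ J * eta in Jd; have dh : delta / 2 < h.
  by rewrite ltr_pdivrMr// mulrC mulrA -exprS.
have h0 : 0 < h by rewrite (le_lt_trans _ dh)// divr_ge0// ltW.
have mKg : measurable_fun I (fun y => (K y * g y)%:E).
  by apply/measurable_EFinP; exact: measurable_funM.
rewrite (@ge0_integral_setD _ _ R mu (ball t h))//; last 2 first.
- exact: ball_subI.
- by move=> y Iy; rewrite lee_fin mulr_ge0 ?K_ge0 ?g_ge0.
apply: leeD.
  apply: le_trans (integralM_ball Jd) _; rewrite lee_fin ler_wpM2l// lerD2l.
  by rewrite ler_piMr ?mulr_ge0// gerBl invr_ge0 exprn_ge0.
have mD : measurable (I `\` ball t h) by exact: measurableD.
apply: le_trans (integralM_outside_ball mD _ h0 _) _; [by move=> y []|by move=> y []|].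
apply: lee_pmul.
- by rewrite lee_fin divr_ge0 ?sqr_ge0// mulr_ge0// ltW.
- by apply: integral_ge0 => y [Iy _]; rewrite lee_fin g_ge0.
- rewrite lee_fin (_ : 4 * B * eta / delta ^+ 2 = B * eta / (delta / 2) ^+ 2); last first.
    by field; rewrite lt0r_neq0.
  rewrite ler_wpM2l ?mulr_ge0 ?(ltW eta_gt0)// lef_pV2 ?posrE ?exprn_gt0 ?divr_gt0//.
  by rewrite lerXn2r ?nnegrE ?(ltW h0) ?(ltW dh)// divr_ge0// ltW.
- by apply: ge0_subset_integral => //; exact/measurable_EFinP.
Qed.

End ApproximateIdentity.

Section PoissonLebesguePoint.
Context {R : realType}.
Local Notation mu := (@lebesgue_measure R).
Implicit Types (f : R -> R) (r t : R).

Lemma lebesgue_pt_mean_le f t (e : R) : 0 < e -> lebesgue_pt f t ->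
  exists2 d : R, 0 < d & forall h, 0 < h -> h < d ->
    (\int[mu]_(y in ball t h) `|f y - f t|%:E <= (e * 2 * h)%:E)%E.
Proof.
move=> e0 /fine_cvgP[fin /cvgr0_norm_lt/(_ e e0) lt].
have : \forall h \near (0 : R)^'+, davg f t h \is a fin_num /\ `|fine (davg f t h)| < e.
  by apply: filterS2 fin lt => h.
move=> /nbhs_ballP[d /= d0 Hd]; exists d => // h h0 hd.
have [] := Hd h _ h0; first by rewrite -ball_normE/= sub0r normrN gtr0_norm.
move=> fi; rewrite ger0_norm ?fine_ge0 ?davg_ge0// => lte.
have : (davg f t h <= e%:E)%E by rewrite -(fineK fi) lee_fin ltW.
rewrite /davg /iavg (lebesgue_measure_ball _ (ltW h0)) inver mulrn_eq0/= gt_eqF//.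
rewrite lee_pdivrMl ?mulrn_wgt0// -EFinM => mean_le.
by rewrite (_ : e * 2 * h = h *+ 2 * e)// -mulr_natl; ring.
Qed.

Lemma turns_centered t y : turns (t - pi) 1 y = (`|y - t| <= pi) :> Prop.
Proof.
rewrite /turns /= in_itv/= ler_norml mulr1n mulr2n addrA subrK.
by rewrite lerBrDl !lerBlDl.
Qed.

Lemma poisson_integral_le (g : R -> R) r t (delta eps : R) :
  2^-1 <= r < 1 -> 1 - r <= delta <= pi -> 0 <= eps -> (forall y, 0 <= g y) ->
  mu.-integrable (turns (t - pi) 1) (EFin \o g) ->
  (forall h, 0 < h -> h <= delta ->
    (\int[mu]_(y in ball t h) (g y)%:E <= (eps * 2 * h)%:E)%E) ->
  (\int[mu]_(y in turns (t - pi) 1) (poisson r (y - t) * g y) <=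
    132 * eps + 64 * (1 - r) / delta ^+ 2 * \int[mu]_(y in turns (t - pi) 1) g y)%R.
Proof.
move=> r2 /andP[r_delta delta_pi] eps0 g0 gi mean_le.
set I := turns _ _ in gi *; have mI := @measurable_turns R (t - pi) 1.
have r01 : 0 <= r < 1 by case/andP: r2 => ? ->; rewrite andbT; lra.
have mg : measurable_fun I g by apply/measurable_EFinP; exact: measurable_int gi.
have mP : measurable_fun I (fun y => poisson r (y - t)) by exact: measurable_poisson.
have Pg_i : mu.-integrable I (EFin \o (fun y => poisson r (y - t) * g y)).
  apply: (@integrable_EFinM _ _ _ _ _ mI (2 / (1 - r))) => // y _.
  exact: norm_poisson_le.
have := @approximate_identity_le R t (1 - r) delta eps 2 16 I g
  (fun y => poisson r (y - t)).
rewrite -EFin_Rintegral// -EFin_Rintegral// -EFinM -EFinD lee_fin.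
rewrite (_ : eps * (_ + _) = 132 * eps); last by ring.
rewrite (_ : 4 * 16 * _ = 64 * (1 - r)); last by ring.
apply=> //.
- by case/andP: r01; lra.
- by move=> y _; exact: poisson_ge0.
- by move=> y _; exact: poisson_le.
- by move=> y; rewrite /I turns_centered => yt; exact: poisson_sqr_le.
- move=> y; rewrite /I turns_centered -ball_normE/= distrC => /ltW/le_trans; exact.
Qed.

Lemma near_left1_between (x : R) : x < 1 -> \forall r \near (1 : R)^'-, x <= r < 1.
Proof.
move=> x1; near=> r; apply/andP; split; near: r; first exact: nbhs_left_ge.
exact: nbhs_left_lt.
Unshelve. all: by end_near. Qed.

Lemma poisson_concentrates f t (e : R) : 0 < e ->
  mu.-integrable (turns (t - pi) 1) (EFin \o f) -> lebesgue_pt f t ->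
  \forall r \near (1 : R)^'-,
    (\int[mu]_(y in turns (t - pi) 1) (poisson r (y - t) * `|f y - f t|) <= e)%R.
Proof.
move=> e0 fi ft; set I := turns _ _ in fi *; have mI := @measurable_turns R (t - pi) 1.
pose g y := `|f y - f t|; have gi : mu.-integrable I (EFin \o g).
  apply: integrable_EFin_norm => //; apply: integrable_EFinB => //.
  by apply: continuous_integrable_turns => y; exact: cvg_cst.
have [d d0 mean_le] := lebesgue_pt_mean_le (divr_gt0 e0 (ltr0n _ 264)) ft.
pose delta := Num.min (d / 2) 1; pose G := (\int[mu]_(y in I) g y)%R.
have delta0 : 0 < delta by rewrite lt_min ltr01 divr_gt0.
have delta_d : delta < d by rewrite gt_min ltr_pdivrMr// ltr_pMr// ltr1n.
have delta_pi : delta <= pi.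
  by apply: le_trans (@pi_ge2 R); rewrite ge_min; apply/orP; right; lra.
have G0 : 0 <= G by apply: Rintegral_ge0 => y _; exact: normr_ge0.
pose rho := e * delta ^+ 2 / (128 * (G + 1)).
have rho0 : 0 < rho by rewrite divr_gt0 ?mulr_gt0 ?exprn_gt0//; lra.
near=> r.
have r2 : 2^-1 <= r < 1 by near: r; apply: near_left1_between; lra.
have r_delta : 1 - delta <= r < 1 by near: r; apply: near_left1_between; lra.
have r_rho : 1 - rho <= r < 1 by near: r; apply: near_left1_between; lra.
apply: le_trans (@poisson_integral_le g r t delta (e / 264) r2 _ _ _ gi _) _.
- by rewrite delta_pi andbT; lra.
- by rewrite divr_ge0// ltW.
- by move=> y; exact: normr_ge0.
- by move=> h h0 hd; apply: mean_le => //; exact: le_lt_trans hd delta_d.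
rewrite [leRHS]splitr; apply: lerD; first by lra.
apply: (@le_trans _ _ (64 * rho / delta ^+ 2 * G)).
  rewrite ler_wpM2r// ler_wpM2r ?invr_ge0 ?sqr_ge0// ler_wpM2l//; lra.
rewrite (_ : _ * G = e / 2 * (G / (G + 1))); last first.
  by rewrite /rho; field; apply/andP; split; apply: lt0r_neq0; lra.
by rewrite ler_piMr ?divr_ge0 ?(ltW e0)// ler_pdivrMr; lra.
Unshelve. all: by end_near. Qed.

Lemma poisson_cvg_lebesgue_pt f t :
  mu.-integrable (turns (t - pi) 1) (EFin \o f) -> lebesgue_pt f t ->
  (\int[mu]_(y in turns (t - pi) 1) (poisson r (y - t) * f y))%R @[r --> (1 : R)^'-] -->
    (pi *+ 2) * f t.
Proof.
move=> fi ft; set I := turns _ _ in fi *; have mI := @measurable_turns R (t - pi) 1.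
apply/cvgrPdist_le => e e0; near=> r.
have r01 : 0 <= r < 1 by near: r; exact: near_left1_between.
have mul_i h : mu.-integrable I (EFin \o h) ->
    mu.-integrable I (EFin \o (fun y => poisson r (y - t) * h y)).
  apply: (@integrable_EFinM _ _ _ _ _ mI (2 / (1 - r))); first exact: measurable_poisson.
  by move=> y _; exact: norm_poisson_le.
have ci : mu.-integrable I (EFin \o (fun=> f t)).
  by apply: continuous_integrable_turns => y; exact: cvg_cst.
have mean_ft : ((pi *+ 2) * f t = \int[mu]_(y in I) (poisson r (y - t) * f t))%R.
  rewrite RintegralZr ?Rintegral_poisson//.
  exact/continuous_integrable_turns/continuous_poisson.
rewrite mean_ft distrC -RintegralB//; [|exact: mul_i|exact: mul_i].
under eq_Rintegral do rewrite -mulrBr.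
have di := integrable_EFinB mI fi ci.
apply: le_trans (le_normr_Rintegral mI (mul_i _ di)) _.
under eq_Rintegral do rewrite normrM (ger0_norm (poisson_ge0 _ r01)).
by near: r; exact: poisson_concentrates.
Unshelve. all: by end_near. Qed.

End PoissonLebesguePoint.

(** * Hilbert spaces *)

Section PreHilbert.
Context {R : realType} {U : lmodType R[i]} (dot : {dot U for Num.conj}).
Local Notation C := R[i].
Local Notation "''[' u , v ]" := (dot u v).
Implicit Types (u v w : U) (a : C) (M : set U).

Definition sqnorm u : R := complex.Re '[u, u].

Lemma dot_self u : '[u, u] = (sqnorm u)%:C%C.
Proof.
by rewrite /sqnorm; have := dnorm_ge0 dot u; case: ('[u, u]) => x y /ger0_Im /= ->.
Qed.

Lemma sqnorm_ge0 u : 0 <= sqnorm u.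
Proof. by rewrite -ler0c -dot_self dnorm_ge0. Qed.

Lemma sqnorm_eq0 u : (sqnorm u == 0) = (u == 0).
Proof. by rewrite -(inj_eq (@complexI R)) -dot_self dnorm_eq0. Qed.

Lemma sqnorm_gt0 u : (0 < sqnorm u) = (u != 0).
Proof. by rewrite lt_def sqnorm_ge0 andbT sqnorm_eq0. Qed.

Lemma dotC u v : '[v, u] = Num.conj '[u, v].
Proof. by rewrite hermC mul1r. Qed.

Lemma dot_eq0C u v : '[u, v] = 0 -> '[v, u] = 0.
Proof. by move=> uv; rewrite dotC uv rmorph0. Qed.

Lemma sqnormZ a u : sqnorm (a *: u) = cmod a ^+ 2 * sqnorm u.
Proof. by rewrite /sqnorm dnormZ normr_cmod -rmorphXn /= dot_self Re_realM. Qed.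

Lemma sqnormD u v : sqnorm (u + v) = sqnorm u + sqnorm v + 2 * complex.Re '[u, v].
Proof.
rewrite /sqnorm dnormD 2!raddfD /=; congr (_ + _).
by case: ('[u, v]) => x y /=; ring.
Qed.

Lemma sqnormB u v : sqnorm (u - v) = sqnorm u + sqnorm v - 2 * complex.Re '[u, v].
Proof. by rewrite sqnormD /sqnorm hnormN linearNr raddfN/= mulrN. Qed.

Lemma sqnorm_subC u v : sqnorm (u - v) = sqnorm (v - u).
Proof. by rewrite /sqnorm -opprB hnormN. Qed.

Lemma parallelogram u v :
  sqnorm (u + v) + sqnorm (u - v) = 2 * (sqnorm u + sqnorm v).
Proof. by rewrite sqnormD sqnormB; ring. Qed.

Definition projcoef u v : C := (sqnorm v)^-1%:C%C * '[u, v].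

Lemma sqnorm_sub_proj u v : 0 < sqnorm v ->
  sqnorm (u - projcoef u v *: v) = sqnorm u - cmod '[u, v] ^+ 2 / sqnorm v.
Proof.
move=> v0; have v_neq0 : sqnorm v != 0 by rewrite lt0r_neq0.
have cross : complex.Re '[u, projcoef u v *: v] = cmod '[u, v] ^+ 2 / sqnorm v.
  rewrite linearZr_LR /= /projcoef; move: '[u, v] => z.
  by rewrite cmod_sqr; case: z => x y /=; field.
have cmod_coef : cmod (projcoef u v) ^+ 2 * sqnorm v = cmod '[u, v] ^+ 2 / sqnorm v.
  by rewrite /projcoef !cmod_sqr; case: '[u, v] => x y /=; field.
by rewrite sqnormB sqnormZ cmod_coef cross; ring.
Qed.

Lemma cauchy_schwarz u v : cmod '[u, v] ^+ 2 <= sqnorm u * sqnorm v.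
Proof.
have [->|v0] := eqVneq v 0.
  by rewrite linear0r cmod0 expr0n mulr_ge0 ?sqnorm_ge0.
rewrite -sqnorm_gt0 in v0; rewrite -ler_pdivrMr// -subr_ge0 -sqnorm_sub_proj//.
exact: sqnorm_ge0.
Qed.

Lemma dot_lim_eq (u_ : nat -> U) u w a :
  (fun n => sqnorm (u_ n - u)) @ \oo --> (0 : R) ->
  (\forall n \near \oo, '[u_ n, w] = a) -> '[u, w] = a.
Proof.
move=> u_u ua; apply/eqP; rewrite eq_sym -subr_eq0 -cmod_eq0; apply/eqP.
apply: (@cvg0_sqr_eq0 _ _ (fun n => sqnorm (u_ n - u) * sqnorm w)).
  by apply: filterS ua => n <-; rewrite -linearBl; exact: cauchy_schwarz.
by rewrite -[X in _ --> X](mul0r (sqnorm w)); apply: cvgM => //; exact: cvg_cst.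
Qed.

Definition closed_submodule M :=
  [/\ M 0, forall a u v, M u -> M v -> M (a *: u + v) &
    forall (u_ : nat -> U) v, (forall n, M (u_ n)) ->
      (fun n => sqnorm (u_ n - v)) @ \oo --> (0 : R) -> M v].

Definition sqnorm_complete := forall (u_ : nat -> U) (e : nat -> R),
  e @ \oo --> (0 : R) ->
  (forall i j, (i <= j)%N -> sqnorm (u_ i - u_ j) <= e i) ->
  exists v, forall i, sqnorm (u_ i - v) <= e i.

Lemma sqnorm_cvg0_le (u_ : nat -> U) v (e : nat -> R) :
  (forall i, sqnorm (u_ i - v) <= e i) -> e @ \oo --> (0 : R) ->
  (fun i => sqnorm (u_ i - v)) @ \oo --> (0 : R).
Proof.
by move=> ue; apply: squeeze_norm_cvg0 => i; rewrite ger0_norm ?sqnorm_ge0.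
Qed.

Lemma closed_submodule_orth {I : Type} (e : I -> U) :
  closed_submodule [set u | forall i, '[u, e i] = 0].
Proof.
split=> /= [i|a u v u0 v0 i|u_ v u0 u_v i]; first by rewrite linear0l.
  by rewrite linearDl linearZl_LR /= u0 v0 mulr0 addr0.
by apply: (dot_lim_eq u_v); apply: nearW => n; exact: u0.
Qed.

Section ClosedSubmodule.
Variable M : set U.
Hypothesis clM : closed_submodule M.

Lemma closed_submodule0 : M 0. Proof. by case: clM. Qed.

Lemma closed_submoduleZ a u : M u -> M (a *: u).
Proof. by case: clM => M0 ML _ Mu; rewrite -[_ *: _]addr0; exact: ML. Qed.

Lemma closed_submoduleD u v : M u -> M v -> M (u + v).
Proof. by case: clM => _ ML _ Mu Mv; rewrite -[u]scale1r; exact: ML. Qed.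

Lemma closed_submoduleB u v : M u -> M v -> M (u - v).
Proof.
by move=> Mu Mv; rewrite -scaleN1r addrC; case: clM => _ ML _; exact: ML.
Qed.

Lemma closed_submodule_lim (u_ : nat -> U) v : (forall n, M (u_ n)) ->
  (fun n => sqnorm (u_ n - v)) @ \oo --> (0 : R) -> M v.
Proof. by case: clM => _ _; exact. Qed.

Lemma closed_submoduleI (N : set U) :
  closed_submodule N -> closed_submodule (M `&` N).
Proof.
case: clM => M0 ML Mlim [N0 NL Nlim]; split=> //.
- by move=> a u v [Mu Nu] [Mv Nv]; split; [exact: ML|exact: NL].
- move=> u_ v MNu u_v; split; first by apply: Mlim u_v => n; case: (MNu n).
  by apply: Nlim u_v => n; case: (MNu n).
Qed.

Section NearMinimizers.
Variables (u : U) (d : R).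
Hypothesis d_le : forall m, M m -> d <= sqnorm (u - m).

Lemma near_minimizers_close m1 m2 (e1 e2 : R) : M m1 -> M m2 ->
  sqnorm (u - m1) <= d + e1 -> sqnorm (u - m2) <= d + e2 ->
  sqnorm (m1 - m2) <= 2 * (e1 + e2).
Proof.
move=> Mm1 Mm2 um1 um2; pose mid := 2^-1 *: (m1 + m2).
have Mmid : M mid by apply: closed_submoduleZ; exact: closed_submoduleD.
have := parallelogram (u - m2) (u - m1).
rewrite opprB [_ + (m1 - u)]addrC subrKA.
have -> : u - m2 + (u - m1) = 2 *: (u - mid).
  rewrite scalerBr scalerA divff ?pnatr_eq0// scale1r scaler_nat mulr2n.
  by rewrite opprD addrACA [- m1 - m2]addrC.
rewrite sqnormZ (_ : cmod 2 ^+ 2 = 4); last by rewrite cmod_sqr /=; ring.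
by have := d_le Mmid; lra.
Qed.

Lemma near_minimizer_dot m v (e : R) : M m -> M v -> sqnorm (u - m) <= d + e ->
  cmod '[u - m, v] ^+ 2 <= e * sqnorm v.
Proof.
move=> Mm Mv um; have [->|v0] := eqVneq v 0.
  by rewrite linear0r cmod0 expr0n /sqnorm linear0r/= mulr0.
rewrite -sqnorm_gt0 in v0; rewrite -ler_pdivrMr//.
have := d_le (closed_submoduleD Mm (closed_submoduleZ (projcoef (u - m) v) Mv)).
by rewrite opprD addrA sqnorm_sub_proj//; lra.
Qed.

End NearMinimizers.

Hypothesis complete : sqnorm_complete.

Theorem projection u : exists2 v, M v & forall m, M m -> '[u - v, m] = 0.
Proof.
pose dist : set R := [set sqnorm (u - m) | m in M].
have dist_inf : has_inf dist.
  split; first by exists (sqnorm (u - 0)), 0 => //; exact: closed_submodule0.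
  by exists 0 => _ [m _ <-]; exact: sqnorm_ge0.
have inf_le m : M m -> inf dist <= sqnorm (u - m).
  by move=> Mm; apply: ge_inf; [case: dist_inf|exists m].
have /choice[m_ Mm_] i : exists m, M m /\ sqnorm (u - m) <= inf dist + harmonic i.
  have [_ [m Mm <-] lt] := inf_adherent (harmonic_gt0 i) dist_inf.
  by exists m; split=> //; exact: ltW.
have harmonic0 (c : R) : (fun i => c * harmonic i) @ \oo --> (0 : R).
  by rewrite -[X in _ --> X](mulr0 c); apply: cvgM; [exact: cvg_cst|exact: cvg_harmonic].
have [i j ij|v m_v] := complete (u_ := m_) (harmonic0 4).
  have [Mi ui] := Mm_ i; have [Mj uj] := Mm_ j.
  apply: le_trans (near_minimizers_close inf_le Mi Mj ui uj) _.
  have : harmonic j <= harmonic i :> R by rewrite /harmonic/= lef_pV2 ?posrE// ler_nat.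
  lra.
have Mv : M v.
  apply: closed_submodule_lim (sqnorm_cvg0_le m_v (harmonic0 4)) => i.
  by case: (Mm_ i).
exists v => // m Mm; apply/eqP; rewrite -cmod_eq0; apply/eqP.
apply: (@cvg0_sqr_eq0 _ _ (fun i => (10 * sqnorm m) * harmonic i)); last exact: harmonic0.
apply: nearW => i; have [Mi ui] := Mm_ i.
have near_orth := near_minimizer_dot inf_le Mi Mm ui.
have close := le_trans (cauchy_schwarz (m_ i - v) m) (ler_wpM2r (sqnorm_ge0 m) (m_v i)).
rewrite -(subrKA (m_ i)) linearDl; move: near_orth close.
set x := '[u - _, m]; set y := '[_ - v, m] => near_orth close.
have := cmod_sqrD_le x y; lra.
Qed.

End ClosedSubmodule.

Section OrthonormalSequence.
Variable e : nat -> U.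
Implicit Types c : nat -> C.

Definition orthonormal_seq := forall j k, '[e j, e k] = (j == k)%:R.

Definition expansion c N : U := \sum_(k < N) c k *: e k.

Lemma closed_submodule_expansion M c N : closed_submodule M ->
  (forall k, (k < N)%N -> M (e k)) -> M (expansion c N).
Proof.
move=> clM Me; apply: (big_ind M) => [|u v|k _].
- exact: closed_submodule0.
- exact: closed_submoduleD.
- by apply: closed_submoduleZ => //; exact: Me.
Qed.

Hypothesis orth : orthonormal_seq.

Lemma dot_expansion c N v : '[expansion c N, v] = \sum_(k < N) c k * '[e k, v].
Proof. by rewrite linear_sumlz; apply: eq_bigr => k _; rewrite linearZl_LR. Qed.

Lemma coord_expansion c N j : '[expansion c N, e j] = if (j < N)%N then c j else 0.
Proof.
rewrite dot_expansion; under eq_bigr do rewrite orth.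
case: ltnP => [jN|Nj].
  rewrite (bigD1 (Ordinal jN))//= eqxx mulr1 big1 ?addr0// => k kj.
  by rewrite (negbTE (_ : k != j :> nat)) ?mulr0.
by rewrite big1// => k _; rewrite ltn_eqF ?mulr0// (leq_trans (ltn_ord k)).
Qed.

Lemma sqnorm_expansion c N : sqnorm (expansion c N) = \sum_(k < N) cmod (c k) ^+ 2.
Proof.
apply: complexI; rewrite -dot_self dot_expansion rmorph_sum/=.
apply: eq_bigr => k _; rewrite dotC coord_expansion ltn_ord.
exact: mul_conj_cmod.
Qed.

Lemma expansion_cutoff c (K N : nat) : (K <= N)%N ->
  expansion (cutoff K c) N = expansion c N - expansion c K.
Proof.
move=> KN; rewrite /expansion -(sum_cutoff (fun k => c k *: e k) KN).
by apply: eq_bigr => k _; rewrite /cutoff; case: ifP => // _; rewrite scale0r.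
Qed.

Lemma bessel u N : \sum_(k < N) cmod '[u, e k] ^+ 2 <= sqnorm u.
Proof.
pose b k := '[u, e k]; have := sqnorm_ge0 (u - expansion b N).
rewrite sqnormB sqnorm_expansion dotC dot_expansion.
have -> : \sum_(k < N) b k * '[e k, u] = (\sum_(k < N) cmod (b k) ^+ 2)%:C%C.
  by rewrite rmorph_sum; apply: eq_bigr => k _; rewrite dotC /= mul_conj_cmod.
by rewrite complex_Re_conj /=; lra.
Qed.

Theorem riesz_fischer c : sqnorm_complete -> is_H2 c ->
  exists v, (forall N, sqnorm (expansion c N - v) <= sqtail c N) /\
    forall j, '[v, e j] = c j.
Proof.
move=> complete c_H2.
have [|v cv] := complete (expansion c) _ (sqtail_cvg0 c_H2).
  move=> i j ij; rewrite sqnorm_subC -expansion_cutoff// sqnorm_expansion.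
  by rewrite sum_cmod_cutoff// lerD2r sum_le_sqsum.
exists v; split=> // j.
apply: (dot_lim_eq (sqnorm_cvg0_le cv (sqtail_cvg0 c_H2))).
by exists j.+1 => // N /= jN; rewrite coord_expansion jN.
Qed.

End OrthonormalSequence.

End PreHilbert.

(** * The Hardy space *)

Section ComplexLimits.
Context {R : realType}.
Local Notation C := R[i].
Implicit Types (c : nat -> C) (a l : C).

Lemma cvg_cmodB {T : Type} (F : set_system T) {FF : Filter F} (u : T -> C) l :
  cmod (u x - l) @[x --> F] --> (0 : R) <->
  complex.Re (u x) @[x --> F] --> complex.Re l /\
  complex.Im (u x) @[x --> F] --> complex.Im l.
Proof.
have ReB x : complex.Re (u x) - complex.Re l = complex.Re (u x - l) by rewrite raddfB.
have ImB x : complex.Im (u x) - complex.Im l = complex.Im (u x - l) by rewrite raddfB.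
split=> [u_l|[/subr_cvg0 Re_l /subr_cvg0 Im_l]].
  split; apply/subr_cvg0/norm_cvg0P; apply: (@squeeze_cvgr _ _ _ _ (fun=> 0)
    (fun x => cmod (u x - l))) => //; try exact: cvg_cst; apply: nearW => x.
    by rewrite normr_ge0 ReB Re_norm_le.
  by rewrite normr_ge0 ImB Im_norm_le.
apply: (@squeeze_cvgr _ _ _ _ (fun=> 0)
  (fun x => `|complex.Re (u x) - complex.Re l| + `|complex.Im (u x) - complex.Im l|)).
- by apply: nearW => x; rewrite cmod_ge0 ReB ImB cmod_le_Re_Im.
- exact: cvg_cst.
- by rewrite -[X in _ --> X](addr0 0); apply: cvgD; exact/norm_cvg0P.
Qed.

Lemma cvg_cmod_unique {T : Type} (F : set_system T) {FF : ProperFilter F} (u : T -> C) l m :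
  cmod (u x - l) @[x --> F] --> (0 : R) -> cmod (u x - m) @[x --> F] --> (0 : R) -> l = m.
Proof.
move=> /cvg_cmodB[Re_l Im_l] /cvg_cmodB[Re_m Im_m].
apply: complex_ext; first exact: (cvg_unique _ Re_l Re_m).
exact: (cvg_unique _ Im_l Im_m).
Qed.

Lemma cseries_to0 : cseries_to (fun=> 0) (0 : C).
Proof.
rewrite /cseries_to; under eq_fun do rewrite big1// subr0 cmod0.
exact: cvg_cst.
Qed.

Lemma cseries_to_linear a c d l m : cseries_to c l -> cseries_to d m ->
  cseries_to (fun k => a * c k + d k) (a * l + m).
Proof.
move=> cl dm; apply: (@squeeze_norm_cvg0 _ _ (fun N =>
  cmod a * cmod (\sum_(k < N) c k - l) + cmod (\sum_(k < N) d k - m))).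
  move=> N; rewrite ger0_norm ?cmod_ge0// -cmodM.
  by rewrite big_split/= -mulr_sumr opprD addrACA -mulrBr cmodD.
rewrite -[X in _ --> X](addr0 0); apply: cvgD dm.
by rewrite -[X in _ --> X](mulr0 (cmod a)); apply: cvgM => //; exact: cvg_cst.
Qed.

Lemma cseries_to_conj c l :
  cseries_to c l -> cseries_to (fun k => Num.conj (c k)) (Num.conj l).
Proof.
rewrite /cseries_to (_ : (fun N => _) = (fun N =>
    cmod (\sum_(k < N) Num.conj (c k) - Num.conj l)))//.
by apply/funext => N; rewrite -[LHS]cmod_conj rmorphB rmorph_sum.
Qed.

Lemma cseries_to_abs c : cvgn (series (fun k => cmod (c k))) ->
  exists l, cseries_to c l.
Proof.
move=> abs_c; have bound (p : C -> R) : (forall z, `|p z| <= cmod z) ->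
    cvgn (series (fun k => p (c k))).
  move=> pc; apply: normed_cvg; apply: nondecreasing_is_cvgn.
    by apply: nondecreasing_series => k _ _; exact: normr_ge0.
  exists (limn (series (fun k => cmod (c k)))) => _ [N _ <-].
  apply: le_trans (nondecreasing_cvgn_le _ abs_c N); last first.
    by apply: nondecreasing_series => k _ _; exact: cmod_ge0.
  by apply: ler_sum => k _; exact: pc.
have /cvg_ex[x Re_x] := bound _ (@Re_norm_le R).
have /cvg_ex[y Im_y] := bound _ (@Im_norm_le R).
exists (Complex x y); apply/cvg_cmodB => /=; split.
- rewrite (_ : (fun N => _) = series (fun k => complex.Re (c k)))//.
  by apply/funext => N; rewrite raddf_sum seriesEord.
- rewrite (_ : (fun N => _) = series (fun k => complex.Im (c k)))//.
  by apply/funext => N; rewrite raddf_sum seriesEord.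
Qed.

Lemma cmod_complete (z : nat -> C) (e : nat -> R) : e @ \oo --> (0 : R) ->
  (forall i j, (i <= j)%N -> cmod (z i - z j) ^+ 2 <= e i) ->
  exists l, (fun i => cmod (z i - l)) @ \oo --> (0 : R).
Proof.
move=> e0 ze.
have /cvg_ex[x Re_x] : cvgn (fun i => complex.Re (z i)).
  apply: cvgn_of_sqr_dist e0 _ => i j ij; apply: le_trans (ze _ _ ij).
  by rewrite cmod_sqr !raddfB lerDl sqr_ge0.
have /cvg_ex[y Im_y] : cvgn (fun i => complex.Im (z i)).
  apply: cvgn_of_sqr_dist e0 _ => i j ij; apply: le_trans (ze _ _ ij).
  by rewrite cmod_sqr !raddfB lerDr sqr_ge0.
by exists (Complex x y); apply/cvg_cmodB.
Qed.

Lemma cvg_cmod_sqr (z : nat -> C) l w : (fun i => cmod (z i - l)) @ \oo --> (0 : R) ->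
  (fun i => cmod (w - z i) ^+ 2) @ \oo --> cmod (w - l) ^+ 2.
Proof.
move=> /cvg_cmodB[Re_l Im_l]; rewrite cmod_sqr !raddfB.
under eq_fun do rewrite cmod_sqr !raddfB.
by apply: cvgD; rewrite !expr2; under eq_fun do rewrite expr2;
  apply: cvgM; (apply: cvgB => //; exact: cvg_cst).
Qed.

End ComplexLimits.

Section HardySpace.
Context {R : realType}.
Local Notation C := R[i].
Local Notation V := (nat -> R[i]).

Definition H2 : {pred V} := [pred f | `[< is_H2 f >]].

Lemma H2P (f : V) : reflect (is_H2 f) (f \in H2).
Proof. exact: asboolP. Qed.

Lemma H2_submod_closed : submod_closed H2.
Proof.
split=> [|a f g /H2P Hf /H2P Hg]; apply/H2P.
  have [] // := @is_H2_sqsum_le R 0 0 => N.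
  by rewrite big1// => k _; rewrite cmod0 expr0n.
have [] // := @is_H2_sqsum_le R (a *: f + g) (2 * cmod a ^+ 2 * sqsum f + 2 * sqsum g).
move=> N; apply: (@le_trans _ _ (\sum_(k < N)
  (2 * cmod a ^+ 2 * cmod (f k) ^+ 2 + 2 * cmod (g k) ^+ 2))).
  apply: ler_sum => k _; rewrite -mulrA -exprMn -cmodM.
  exact: (cmod_sqrD_le (a * f k) (g k)).
rewrite big_split/= -!mulr_sumr; apply: lerD; apply: ler_wpM2l => //.
- by rewrite mulr_ge0// sqr_ge0.
- exact: sum_le_sqsum.
- exact: sum_le_sqsum.
Qed.

HB.instance Definition _ := GRing.isSubmodClosed.Build C V H2 H2_submod_closed.

Record h2 := H2Seq { h2val :> V; h2valP : h2val \in H2 }.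

HB.instance Definition _ := [isSub for h2val].
HB.instance Definition _ := [Choice of h2 by <:].
HB.instance Definition _ := [SubChoice_isSubLmodule of h2 by <:].

Implicit Types f g : h2.

Lemma h2_is_H2 f : is_H2 f.
Proof. exact/H2P/h2valP. Qed.
Arguments h2_is_H2 : clear implicits.

Lemma is_H2_h2 (f : V) : is_H2 f -> exists g : h2, g = f :> V.
Proof. by move=> /H2P Hf; exists (H2Seq Hf). Qed.

Lemma h2P f g : f =1 g -> f = g.
Proof. by move=> fg; apply: val_inj; exact/funext. Qed.

Lemma h2_sumE {I : Type} (r : seq I) (P : pred I) (F : I -> h2) k :
  (\sum_(i <- r | P i) F i) k = \sum_(i <- r | P i) F i k.
Proof. exact: (big_morph (fun f : h2 => f k)). Qed.

Definition hform f g : C :=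
  Complex (limn (series (fun k => complex.Re (f k * Num.conj (g k)))))
          (limn (series (fun k => complex.Im (f k * Num.conj (g k))))).

Lemma hform_cseries f g : cseries_to (fun k => f k * Num.conj (g k)) (hform f g).
Proof.
have [|l fg_l] := @cseries_to_abs R (fun k => f k * Num.conj (g k)).
  apply: nondecreasing_is_cvgn.
    by apply: nondecreasing_series => k _ _; exact: cmod_ge0.
  exists (sqsum f + sqsum g) => _ [N _ <-]; rewrite seriesEord/=.
  apply: le_trans (lerD (sum_le_sqsum N (h2_is_H2 f)) (sum_le_sqsum N (h2_is_H2 g))).
  rewrite -big_split/=; apply: ler_sum => k _; rewrite cmodM cmod_conj.
  have := sqr_ge0 (cmod (f k) - cmod (g k)); have := sqr_ge0 (cmod (f k)).
  by have := sqr_ge0 (cmod (g k)); nra.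
rewrite (_ : hform f g = l)//; move/cvg_cmodB: fg_l => [Re_l Im_l].
apply: complex_ext; apply: cvg_lim => //.
- rewrite (_ : series _ = fun N => complex.Re (\sum_(k < N) f k * Num.conj (g k)))//.
  by apply/funext => N; rewrite raddf_sum seriesEord.
- rewrite (_ : series _ = fun N => complex.Im (\sum_(k < N) f k * Num.conj (g k)))//.
  by apply/funext => N; rewrite raddf_sum seriesEord.
Qed.

Lemma hform_unique f g (l : C) :
  cseries_to (fun k => f k * Num.conj (g k)) l -> hform f g = l.
Proof. exact: cvg_cmod_unique (hform_cseries f g). Qed.

Lemma hform_hermitian f g : hform f g = (-1) ^+ false * Num.conj (hform g f).
Proof.
rewrite mul1r; apply: hform_unique; have := cseries_to_conj (hform_cseries g f).
congr cseries_to; apply/funext => k.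
by rewrite rmorphM /= conjCK mulrC.
Qed.

Lemma hform_linearl g : linear_for *%R (hform ^~ g).
Proof.
move=> a f f'; apply: hform_unique.
have := cseries_to_linear a (hform_cseries f g) (hform_cseries f' g).
congr cseries_to; apply/funext => k.
by rewrite mulrA -mulrDl.
Qed.

Lemma hform_bilinear : bilinear_for (GRing.Scale.Law.clone _ _ *%R _)
  (GRing.Scale.Law.clone _ _ (Num.conj \; *%R) _) hform.
Proof.
split=> [g|f]; first exact: hform_linearl.
by move=> a g g'; rewrite !(hform_hermitian f) hform_linearl /= !mul1r rmorphD rmorphM.
Qed.

Lemma hform_self f : hform f f = (sqsum f)%:C%C.
Proof.
apply: hform_unique; apply/cvg_cmodB; split=> /=.
  rewrite (_ : (fun N => _) = fun N => \sum_(k < N) cmod (f k) ^+ 2).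
    exact/sqsum_cvg/h2_is_H2.
  by apply/funext => N; rewrite raddf_sum; apply: eq_bigr => k _; rewrite mul_conj_cmod.
rewrite (_ : (fun N => _) = fun=> 0); first exact: cvg_cst.
by apply/funext => N; rewrite raddf_sum big1// => k _; rewrite mul_conj_cmod.
Qed.

Lemma hform_gt0 f : f != 0 -> 0 < hform f f.
Proof.
move=> f0; rewrite hform_self ltcR lt_neqAle.
have Hf := h2_is_H2 f; have sq_ge0 : 0 <= sqsum f.
  by have := sum_le_sqsum 0 Hf; rewrite big_ord0.
rewrite sq_ge0 andbT; apply: contra f0 => /eqP sq0; apply/eqP/h2P => k.
apply/eqP; rewrite -cmod_eq0 -sqrf_eq0 eq_le sqr_ge0 andbT sq0.
exact: cmod_sqr_le_sqsum.
Qed.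

HB.instance Definition _ :=
  bilinear_isBilinear.Build C h2 h2 C *%R (Num.conj \; *%R) hform hform_bilinear.
HB.instance Definition _ :=
  isHermitianSesquilinear.Build C h2 false Num.conj hform hform_hermitian.
HB.instance Definition _ := isDotProduct.Build C h2 hform hform_gt0.

Definition hdot : {dot h2 for Num.conj} := hform.

Lemma hdotE f g (l : C) : cseries_to (fun k => f k * Num.conj (g k)) l -> hdot f g = l.
Proof. exact: hform_unique. Qed.

Lemma hdot_cseries f g : cseries_to (fun k => f k * Num.conj (g k)) (hdot f g).
Proof. exact: hform_cseries. Qed.

Lemma sqnormE f : sqnorm hdot f = sqsum f.
Proof. exact: (congr1 (@complex.Re R) (hform_self f)). Qed.

Lemma h2normE f : h2norm f = Num.sqrt (sqnorm hdot f).
Proof. by rewrite sqnormE. Qed.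

Lemma cmod_le_sqnorm f k : cmod (f k) ^+ 2 <= sqnorm hdot f.
Proof. by rewrite sqnormE; apply: cmod_sqr_le_sqsum; exact: h2_is_H2. Qed.

Lemma h2_coord_lim_eq (f_ : nat -> h2) f k (a : C) :
  (fun i => sqnorm hdot (f_ i - f)) @ \oo --> (0 : R) ->
  (\forall i \near \oo, f_ i k = a) -> f k = a.
Proof.
move=> f_f fa; apply/eqP; rewrite eq_sym -subr_eq0 -cmod_eq0; apply/eqP.
apply: cvg0_sqr_eq0 f_f; apply: filterS fa => i <-.
exact: (cmod_le_sqnorm (f_ i - f)).
Qed.

Lemma h2_complete : sqnorm_complete hdot.
Proof.
move=> u_ e e0 ue.
have /choice[v u_v] k : exists l, (fun i => cmod (u_ i k - l)) @ \oo --> (0 : R).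
  apply: cmod_complete e0 _ => i j ij; apply: le_trans (ue i j ij).
  exact: (cmod_le_sqnorm (u_ i - u_ j)).
have partial_le i N : \sum_(k < N) cmod (u_ i k - v k) ^+ 2 <= e i.
  have cvg_partial : (fun j => \sum_(k < N) cmod (u_ i k - u_ j k) ^+ 2) @ \oo -->
      \sum_(k < N) cmod (u_ i k - v k) ^+ 2.
    by apply: cvg_big => [|k _]; [exact: add_continuous|exact: cvg_cmod_sqr].
  apply: cvgr_to_le cvg_partial _; exists i => // j /= ij; apply: le_trans (ue i j ij).
  by rewrite sqnormE; apply: (sum_le_sqsum N); exact: (h2_is_H2 (u_ i - u_ j)).
have dist_H2 i := is_H2_sqsum_le (c := fun k => u_ i k - v k) (partial_le i).
have /is_H2_h2[d0 d0E] := (dist_H2 0%N).1.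
exists (u_ 0%N - d0) => i; rewrite sqnormE.
rewrite (_ : h2val _ = fun k => u_ i k - v k); first exact: (dist_H2 i).2.
apply/funext => k; rewrite -[LHS]/(u_ i k - (u_ 0%N k - d0 k)) d0E.
by rewrite subKr.
Qed.

Section ClosedSubspace.
Variable M : set V.
Hypothesis clM : closed_subspace M.

Lemma closed_subspace_h2 (f : V) : M f -> exists2 g : h2, g = f :> V & M g.
Proof.
by case: clM => MH _ _ _ Mf; have [g gf] := is_H2_h2 (MH f Mf); exists g; rewrite ?gf.
Qed.

Lemma closed_subspace_submodule : closed_submodule hdot [set f : h2 | M f].
Proof.
case: clM => MH M0 ML Mlim; split=> //= [a f g|u_ v Mu u_v]; first exact: ML.
apply: (Mlim (fun i => u_ i)) => //; first exact: h2_is_H2.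
rewrite (_ : (fun i => _) = fun i => Num.sqrt (sqnorm hdot (u_ i - v))).
  rewrite -(sqrtr0 R).
  exact: (@cvg_comp _ _ _ _ (@Num.sqrt R) _ _ _ u_v (@sqrt_continuous R 0)).
by apply/funext => i; rewrite -h2normE.
Qed.

End ClosedSubspace.

Lemma hdot_h2orth f g : hdot f g = 0 -> h2orth f g.
Proof. by rewrite /h2orth => <-; exact: hdot_cseries. Qed.

End HardySpace.
Arguments h2_is_H2 {R} f.

(** * Shift-invariant subspaces *)

Section PowerSeries.
Context {R : realType}.
Local Notation C := R[i].
Local Notation V := (nat -> R[i]).
Implicit Types (f g h : V).

Definition zshift m f : V := fun k => if (m <= k)%N then f (k - m)%N else 0.

Lemma zshift_is_linear m : linear (zshift m).
Proof.
move=> a f g; apply/funext => k.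
rewrite -[RHS]/(a * zshift m f k + zshift m g k) /zshift.
by case: ifP => // _; rewrite mulr0 addr0.
Qed.

HB.instance Definition _ m := GRing.isLinear.Build C V V _ (zshift m) (zshift_is_linear m).

Lemma MzE f : Mz f = zshift 1 f.
Proof. by apply/funext => -[|k]; rewrite /zshift//= subn1. Qed.

Lemma zshift0 f : zshift 0 f = f.
Proof. by apply/funext => k; rewrite /zshift subn0. Qed.

Lemma zshiftD m n f : zshift (m + n) f = zshift m (zshift n f).
Proof.
apply/funext => k; rewrite /zshift; have [mk|km] := leqP m k.
  by rewrite leq_subRL// subnDA.
by rewrite leqNgt (leq_trans km) ?leq_addr.
Qed.

Definition vanish_below m : set V := [set f | forall k, (k < m)%N -> f k = 0].

Lemma vanish_below_le m n : (m <= n)%N -> vanish_below n `<=` vanish_below m.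
Proof. by move=> mn f f0 k km; apply: f0; exact: leq_trans mn. Qed.

Lemma zshift_below m f : vanish_below m (zshift m f).
Proof. by move=> k; rewrite /zshift ltnNge => /negbTE->. Qed.

Lemma zshift_addn m f k : zshift m f (k + m)%N = f k.
Proof. by rewrite /zshift leq_addl addnK. Qed.

Lemma zshift_unshift m f : vanish_below m f -> f = zshift m (fun k => f (k + m)%N).
Proof.
move=> f0; apply/funext => k; rewrite /zshift; case: leqP => [mk|/f0//].
by rewrite subnK.
Qed.

Lemma sum_zshift f m N : \sum_(k < N + m) zshift m f k = \sum_(k < N) f k.
Proof.
rewrite addnC big_split_ord/= big1 ?add0r => [|k _]; last by rewrite zshift_below.
by apply: eq_bigr => k _; rewrite addnC zshift_addn.
Qed.

Lemma cseries_to_zshift f m (l : C) : cseries_to f l -> cseries_to (zshift m f) l.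
Proof.
rewrite /cseries_to => fl.
rewrite -(cvg_shiftn m (fun N => cmod (\sum_(k < N) zshift m f k - l))).
by under eq_fun do rewrite sum_zshift.
Qed.

Lemma cmulC f g : cmul f g = cmul g f.
Proof.
apply/funext => k; rewrite /cmul (reindex_inj rev_ord_inj)/=; apply: eq_bigr => j _.
by rewrite subSS mulrC subKn// -ltnS.
Qed.

Lemma cmul_is_linear h : linear (cmul h).
Proof.
move=> a f g; apply/funext => k; rewrite -[RHS]/(a * cmul h f k + cmul h g k).
rewrite /cmul mulr_sumr -big_split/=; apply: eq_bigr => j _.
by rewrite -[X in _ * X = _]/(a * f _ + g _); ring.
Qed.

HB.instance Definition _ h := GRing.isLinear.Build C V V _ (cmul h) (cmul_is_linear h).

Lemma cmul_zshift m f h : cmul h (zshift m f) = zshift m (cmul h f).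
Proof.
elim: m => [|m IH]; first by rewrite !zshift0.
rewrite -add1n !zshiftD -IH; set g := zshift m f.
rewrite -!MzE; apply/funext => -[|k]; rewrite /cmul/=.
  by rewrite big_ord_recl big_ord0 mulr0 addr0.
rewrite big_ord_recr/= subnn/= mulr0 addr0; apply: eq_bigr => j _.
by rewrite subSn// -ltnS.
Qed.

Lemma coefs_XnM m (p : {poly C}) : coefs ('X^m * p) = zshift m (coefs p).
Proof. by apply/funext => k; rewrite /coefs /zshift coefXnM ltnNge; case: leqP. Qed.

Lemma cmul1 f : cmul (coefs 1) f = f.
Proof.
apply/funext => k; rewrite /cmul big_ord_recl/= /coefs coefC eqxx mul1r subn0.
by rewrite big1 ?addr0// => j _; rewrite coefC/= mul0r.
Qed.

Lemma cmul_XnM m (p : {poly C}) f :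
  cmul (coefs ('X^m * p)) f = zshift m (cmul (coefs p) f).
Proof. by rewrite coefs_XnM cmulC cmul_zshift cmulC. Qed.

Lemma cmul_Xn m f : cmul (coefs 'X^m) f = zshift m f.
Proof. by rewrite -[X in coefs X]mulr1 cmul_XnM cmul1. Qed.

Lemma cmul_sum_zshift f g N j : (j < N)%N ->
  cmul f g j = \sum_(k < N) g k * zshift k f j.
Proof.
move=> jN; rewrite cmulC /cmul (big_ord_widen N (fun k => g k * f (j - k)%N))//.
rewrite big_mkcond; apply: eq_bigr => k _; rewrite /zshift ltnS.
by case: ifP => // _; rewrite mulr0.
Qed.

End PowerSeries.

Section Shift.
Context {R : realType}.
Local Notation C := R[i].
Local Notation V := (nat -> R[i]).
Local Notation h2 := (@h2 R).
Local Notation "''[' f , g ]" := (hdot f g).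
Implicit Types (f g h theta : h2) (M : set h2).

Lemma zshift_H2 m f : zshift m f \in H2.
Proof.
apply/H2P; have [] // := @is_H2_sqsum_le R (zshift m f) (sqsum f) => N.
have sqE k : cmod (zshift m f k) ^+ 2 =
    complex.Re (zshift m (fun k => (cmod (f k) ^+ 2)%:C%C) k).
  by rewrite /zshift; case: ifP; rewrite // cmod0 expr0n.
apply: (@le_trans _ _ (\sum_(k < N + m) cmod (zshift m f k) ^+ 2)).
  by rewrite big_split_ord/= lerDl sumr_ge0// => k _; rewrite sqr_ge0.
under eq_bigr do rewrite sqE.
rewrite -raddf_sum sum_zshift raddf_sum; apply: sum_le_sqsum; exact: h2_is_H2.
Qed.

Definition h2shift m f : h2 := H2Seq (zshift_H2 m f).

Lemma h2shift_is_linear m : linear (h2shift m).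
Proof. by move=> a f g; apply: val_inj; rewrite /= linearP. Qed.

HB.instance Definition _ m :=
  GRing.isLinear.Build C h2 h2 _ (h2shift m) (h2shift_is_linear m).

Lemma h2shift0 f : h2shift 0 f = f.
Proof. by apply: val_inj; exact: zshift0. Qed.

Lemma h2shiftD m n f : h2shift (m + n) f = h2shift m (h2shift n f).
Proof. by apply: val_inj; exact: zshiftD. Qed.

Lemma dot_h2shift m f g : '[h2shift m f, h2shift m g] = '[f, g].
Proof.
apply: hdotE; have := cseries_to_zshift m (hdot_cseries f g).
congr cseries_to; apply/funext => k.
by rewrite /= /zshift; case: ifP => // _; rewrite mul0r.
Qed.

Lemma sqnorm_h2shift m f : sqnorm hdot (h2shift m f) = sqnorm hdot f.
Proof. by rewrite /sqnorm dot_h2shift. Qed.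

Lemma h2_unshift m f : vanish_below m f -> exists g, f = h2shift m g.
Proof.
move=> f0; have fE := zshift_unshift f0.
have /is_H2_h2[g gE] : is_H2 (fun k => f (k + m)%N).
  have [] // := @is_H2_sqsum_le R (fun k => f (k + m)%N) (sqsum f) => N.
  apply: le_trans (sum_le_sqsum (m + N) (h2_is_H2 f)).
  rewrite big_split_ord/= -[leLHS]add0r lerD ?sumr_ge0//.
    by move=> k _; rewrite sqr_ge0.
  by apply: ler_sum => k _; rewrite addnC.
by exists g; apply: val_inj; rewrite /= gE.
Qed.

Lemma closed_submodule_vanish m : closed_submodule hdot
  [set f : h2 | vanish_below m f].
Proof.
split=> /= [//|a f g f0 g0 k km|f_ f f0 f_f k km].
  by rewrite -[LHS]/(a * f k + g k) f0// g0// mulr0 addr0.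
by apply: (h2_coord_lim_eq f_f); apply: nearW => i; exact: f0.
Qed.

Lemma closed_submodule_h2shift M m : closed_submodule hdot M ->
  closed_submodule hdot [set h2shift m g | g in M].
Proof.
move=> clM; split=> [|a _ _ [f Mf <-] [g Mg <-]|f_ f Mf_ f_f].
- by exists 0; [exact: closed_submodule0 clM|rewrite linear0].
- exists (a *: f + g); last by rewrite linearP.
  by apply: (closed_submoduleD clM) => //; exact: (closed_submoduleZ clM).
have /choice[g_ gP] i : exists g, M g /\ h2shift m g = f_ i.
  by have [g] := Mf_ i; exists g.
have [|g fE] := @h2_unshift m f.
  case: (closed_submodule_vanish m) => _ _; apply; last exact: f_f.
  by move=> i k km; have [_ <-] := gP i; exact: zshift_below.
exists g => //; apply: (closed_submodule_lim clM (u_ := g_)) => [i|]; first by case: (gP i).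
rewrite (_ : (fun i => _) = fun i => sqnorm hdot (f_ i - f))//.
by apply/funext => i; have [_ <-] := gP i; rewrite fE -linearB sqnorm_h2shift.
Qed.

Lemma closed_submodule_unshift M m : closed_submodule hdot M ->
  closed_submodule hdot [set g | M (h2shift m g)].
Proof.
move=> [M0 ML Mlim]; split=> [|a f g Mf Mg|f_ f Mf_ f_f] /=.
- by rewrite linear0.
- by rewrite linearP; exact: ML.
- apply: (Mlim _ _ Mf_); rewrite (_ : (fun i => _) = fun i => sqnorm hdot (f_ i - f))//.
  by apply/funext => i; rewrite -linearB sqnorm_h2shift.
Qed.

Definition shift_invariant M :=
  closed_submodule hdot M /\ forall f, M f -> M (h2shift 1 f).

Lemma shift_invariantX M m f : shift_invariant M -> M f -> M (h2shift m f).
Proof.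
move=> [_ zM] Mf; elim: m => [|m IH]; first by rewrite h2shift0.
by rewrite -add1n h2shiftD; exact: zM.
Qed.

Definition orthonormal_shifts theta := orthonormal_seq hdot (h2shift^~ theta).

Lemma expansion_h2shift theta (c : V) N j : (j < N)%N ->
  expansion (h2shift^~ theta) c N j = cmul theta c j.
Proof. by move=> jN; rewrite (cmul_sum_zshift _ _ jN) h2_sumE. Qed.

Lemma orthonormal_shifts_mul theta h : orthonormal_shifts theta ->
  exists g, [/\ g = cmul theta h :> V, forall j, '[g, h2shift j theta] = h j &
    forall M, shift_invariant M -> M theta -> M g].
Proof.
move=> orth; have [g [h_g coord]] := riesz_fischer orth (@h2_complete R) (h2_is_H2 h).
have cvg_g := sqnorm_cvg0_le h_g (sqtail_cvg0 (h2_is_H2 h)).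
exists g; split=> // [|M Minv Mtheta].
  apply/funext => j; apply: (h2_coord_lim_eq cvg_g).
  by exists j.+1 => // N /= jN; exact: expansion_h2shift.
apply: (closed_submodule_lim Minv.1 _ cvg_g) => N.
by apply: (closed_submodule_expansion _ Minv.1) => k _; exact: shift_invariantX.
Qed.

Lemma least_order M f : M f -> f != 0 -> exists m, (exists g, M g /\ g m != 0) /\
  forall k, (k < m)%N -> forall g, M g -> g k = 0.
Proof.
move=> Mf f0; have ex_m : exists m, `[< exists g, M g /\ g m != 0 >].
  apply: contrapT => none; move/eqP: f0; apply; apply: h2P => k.
  by apply: contrapT => /eqP fk; apply: none; exists k; apply/asboolP; exists f.
have [m /asboolP gm min_m] := ex_minnP ex_m; exists m; split=> // k km g Mg.
apply: contrapT => /eqP gk; have := min_m k; rewrite leqNgt km => /implyP.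
by rewrite implybF => /asboolP; apply; exists g.
Qed.

Lemma h2_normalize f : f != 0 -> exists2 a : C, a != 0 & sqnorm hdot (a *: f) = 1.
Proof.
rewrite -(sqnorm_gt0 hdot) => f_gt0; set s := Num.sqrt (sqnorm hdot f).
have s_neq0 : s != 0 by rewrite lt0r_neq0// sqrtr_gt0.
exists (s^-1)%:C%C.
  by rewrite -cmod_eq0 -sqrf_eq0 cmod_sqr/= expr0n addr0 sqrf_eq0 invr_eq0.
rewrite sqnormZ cmod_sqr/= expr0n addr0 exprVn sqr_sqrtr ?(ltW f_gt0)// mulVf//.
by rewrite lt0r_neq0.
Qed.

Lemma wandering_orthonormal theta : sqnorm hdot theta = 1 ->
  (forall m, '[theta, h2shift m.+1 theta] = 0) -> orthonormal_shifts theta.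
Proof.
move=> norm1 orth; have lt_orth j k : (j < k)%N -> '[h2shift j theta, h2shift k theta] = 0.
  move=> jk; rewrite -(subnKC (ltnW jk)) h2shiftD dot_h2shift.
  by rewrite -(prednK (n := k - j)) ?subn_gt0.
move=> j k /=; have [jk|kj|->] := ltngtP j k; first exact: lt_orth.
  by apply: dot_eq0C; exact: lt_orth.
by rewrite dot_h2shift (dot_self hdot) norm1.
Qed.

Lemma wandering_vector M f : shift_invariant M -> M f -> f != 0 ->
  exists theta, [/\ M theta, orthonormal_shifts theta &
    forall g, M g -> '[theta, h2shift 1 g] = 0].
Proof.
move=> Minv Mf f0; have [clM zM] := Minv.
have [m [[e [Me em]] min_m]] := least_order Mf f0.
have [_ [g Mg <-] orth] := projection (closed_submodule_h2shift 1 clM) (@h2_complete R) e.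
pose psi := e - h2shift 1 g; have psi0 : psi != 0.
  apply: contra em => /eqP/(congr1 (fun p : h2 => p m)) /=.
  rewrite -[LHS]/(e m - zshift 1 g m).
  rewrite -MzE; case: m min_m => [|m] min_m /=; first by rewrite subr0 => ->.
  by rewrite (min_m m (ltnSn m) g Mg) subr0 => ->.
have [a _ norm1] := h2_normalize psi0.
have Mtheta : M (a *: psi).
  by apply: (closed_submoduleZ clM); apply: (closed_submoduleB clM) => //; exact: zM.
have theta_orth h : M h -> '[a *: psi, h2shift 1 h] = 0.
  by move=> Mh; rewrite linearZl_LR/= orth ?mulr0//; exists h.
exists (a *: psi); split=> //; apply: wandering_orthonormal => // k.
by rewrite -add1n h2shiftD; apply: theta_orth; exact: shift_invariantX.
Qed.

Lemma shift_invariant_orth M theta : shift_invariant M ->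
  (forall g, M g -> '[theta, h2shift 1 g] = 0) ->
  shift_invariant (M `&` [set g | forall j, '[g, h2shift j theta] = 0]).
Proof.
move=> [clM zM] orth; split.
  apply: (closed_submoduleI clM).
  exact: closed_submodule_orth.
move=> g [Mg g_orth]; split; first exact: zM.
case=> [|j]; last by rewrite -(add1n j) h2shiftD dot_h2shift.
by rewrite h2shift0; apply: dot_eq0C; exact: orth.
Qed.

(* The part [K] of [M] orthogonal to [theta H^2] is again shift invariant.
   A nonzero [K] would contain [theta' H^2] for some [theta'], and the product of
   [theta] and [theta'] would lie both in [K] and in [theta H^2]. *)
Theorem beurling M f0 : shift_invariant M -> M f0 -> f0 != 0 ->
  exists2 theta, orthonormal_shifts theta &
    forall f, M f <-> exists h, f = cmul theta h :> V.
Proof.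
move=> Minv Mf0 f0_neq0.
have [theta [Mtheta orth wander]] := wandering_vector Minv Mf0 f0_neq0.
have mul_M h g : g = cmul theta h :> V -> M g /\ forall j, '[g, h2shift j theta] = h j.
  move=> gE; have [g' [g'E coord Mg]] := orthonormal_shifts_mul h orth.
  by rewrite (_ : g = g'); [split=> //; exact: Mg|apply: val_inj; rewrite /= gE].
have Kinv := shift_invariant_orth Minv wander; set K := _ `&` _ in Kinv.
have K0 g : K g -> g = 0.
  move=> Kg; apply/eqP; apply: contrapT => /negP g0.
  have [theta' [Ktheta' orth' _]] := wandering_vector Kinv Kg g0.
  have [prod [prodE _ Kprod]] := orthonormal_shifts_mul theta orth'.
  have [_ prod_orth] := Kprod K Kinv Ktheta'.
  have := orth' 0 0; rewrite h2shift0 (_ : theta' = 0) /= ?linear0l => [/esym/eqP|].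
    by rewrite oner_eq0.
  apply: h2P => j; rewrite cmulC in prodE.
  by rewrite -((mul_M _ _ prodE).2 j) prod_orth.
exists theta => // f; split=> [Mf|[h /mul_M[]]//].
have /is_H2_h2[h hE] : is_H2 (fun k => '[f, h2shift k theta]).
  by apply: (is_H2_sqsum_le (B := sqnorm hdot f) _).1 => N; exact: bessel orth f N.
have [g [gE coord /(_ M Minv Mtheta) Mg]] := orthonormal_shifts_mul h orth.
exists h; rewrite -gE; congr h2val; apply/eqP; rewrite -subr_eq0; apply/eqP/K0.
split; first exact: (closed_submoduleB Minv.1).
by move=> j; rewrite linearBl/= coord hE subrr.
Qed.

End Shift.

(** * Boundary values of inner functions *)

Section Fatou.
Context {R : realType}.
Local Notation mu := (@lebesgue_measure R).
Local Notation C := R[i].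
Implicit Types (c : nat -> C) (r t x : R) (m : nat) (u v : R -> R) (W : C -> C).

Lemma Re_taylor_integrable c N r x m :
  mu.-integrable (turns x m) (EFin \o (fun t => complex.Re (taylor c N (polar r t)))).
Proof. exact/continuous_integrable_turns/continuous_Re_taylor. Qed.

Lemma Re_taylor_sqr_integrable c N r x m :
  mu.-integrable (turns x m) (EFin \o (fun t => complex.Re (taylor c N (polar r t)) ^+ 2)).
Proof.
apply: continuous_integrable_turns => t; under eq_fun do rewrite expr2.
by apply: cvgM; exact: continuous_Re_taylor.
Qed.

Lemma Rintegral_Re_taylor_sqr_le c N x m :
  (\int[mu]_(t in turns x m) (complex.Re (taylor c N (polar 1 t)) ^+ 2) <=
   (pi *+ 2 *+ m) * \sum_(k < N) cmod (c k) ^+ 2)%R.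
Proof.
have := parseval c 1 x m N; under eq_bigr do rewrite expr1n mulr1; move=> <-.
apply: le_Rintegral; first exact: measurable_turns.
- exact: Re_taylor_sqr_integrable.
- exact/continuous_integrable_turns/continuous_cmod_taylor_sqr.
- by move=> t _; rewrite cmod_sqr lerDl sqr_ge0.
Qed.

Lemma boundary_function c x m : is_H2 c -> exists (n_ : nat -> nat) u,
  [/\ forall k, (k <= n_ k)%N, mu.-integrable (turns x m) (EFin \o u) &
    (fun k => \int[mu]_(t in turns x m)
      `|complex.Re (taylor c (n_ k) (polar 1 t)) - u t|)%R @ \oo --> (0 : R)].
Proof.
move=> c_H2; have mD := @measurable_turns R x m.
pose L : R := pi *+ 2 *+ m; have L0 : 0 <= L by exact: turns_length_ge0.
have d0 k : 0 < 4^-1 ^+ k / (L + 1) by rewrite divr_gt0 ?exprn_gt0 ?invr_gt0// ltr_wpDl.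
have [n_ [n_ge n_mono n_fast]] := fast_subseq (sqtail_cvg0 c_H2) d0.
pose F k t := complex.Re (taylor c (n_ k) (polar 1 t)).
have F_increment k t : F k.+1 t - F k t =
    complex.Re (taylor (cutoff (n_ k) c) (n_ k.+1) (polar 1 t)).
  by rewrite taylor_cutoff// raddfB.
have [||||u ui F_u] := @L1_complete_fast_L2 _ _ R mu _ mD F.
- by rewrite /= lebesgue_measure_turns ltry.
- by move=> k; exact: Re_taylor_integrable.
- move=> k; under eq_fun do rewrite F_increment.
  exact: Re_taylor_sqr_integrable.
- move=> k; under eq_Rintegral do rewrite F_increment.
  apply: le_trans (Rintegral_Re_taylor_sqr_le _ _ _ _) _; rewrite -/L sum_cmod_cutoff//.
  apply: (@le_trans _ _ (L * (4^-1 ^+ k / (L + 1)))).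
    rewrite ler_wpM2l//; apply: le_trans (n_fast k _ (leqnn _)).
    by apply: le_trans (ler_norm _); rewrite lerD2r sum_le_sqsum.
  by rewrite mulrCA ler_piMr ?exprn_ge0 ?invr_ge0// ler_pdivrMr ?mul1r ?lerDl// ltr_wpDl.
by exists n_, u.
Qed.

Section RadialLimit.
Variables (c : nat -> C) (W : C -> C).
Hypothesis c_H2 : is_H2 c.
Hypothesis c_W : forall z, cmod z < 1 -> cseries_to (fun k => c k * z ^+ k) (W z).

Let taylor_cvg r t : 0 <= r < 1 ->
  (fun N => cmod (taylor c N (polar r t) - W (polar r t))) @ \oo --> (0 : R).
Proof. by move=> /andP[r0 r1]; apply: c_W; rewrite cmod_polar. Qed.

Lemma Rintegral_poisson_boundary (n_ : nat -> nat) u r t : 0 <= r < 1 ->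
  (forall k, (k <= n_ k)%N) -> mu.-integrable (turns (t - pi) 1) (EFin \o u) ->
  (fun k => \int[mu]_(y in turns (t - pi) 1)
    `|complex.Re (taylor c (n_ k) (polar 1 y)) - u y|)%R @ \oo --> (0 : R) ->
  (\int[mu]_(y in turns (t - pi) 1) (poisson r (y - t) * u y) =
    (pi *+ 2) * complex.Re (W (polar r t)))%R.
Proof.
move=> r01 n_ge ui taylor_u; have mD := @measurable_turns R (t - pi) 1.
have [Re_W _] := (cvg_cmodB _ _).1 (taylor_cvg t r01).
have poisson_u : (fun k => \int[mu]_(y in turns (t - pi) 1)
    (poisson r (y - t) * complex.Re (taylor c (n_ k) (polar 1 y))))%R @ \oo -->
    (\int[mu]_(y in turns (t - pi) 1) (poisson r (y - t) * u y))%R.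
  apply: (@cvg_Rintegral_mul_bounded _ _ R mu _ mD (2 / (1 - r))) => //.
  - exact: measurable_poisson.
  - by move=> y _; exact: norm_poisson_le.
  - by move=> k; exact: Re_taylor_integrable.
apply: (cvg_unique (@Rhausdorff R) poisson_u).
rewrite (funext (fun k => poisson_Re_taylor t r01 c (n_ k))).
apply: cvgM; first exact: cvg_cst.
exact: (cvg_subseq n_ge Re_W).
Qed.

Lemma turns_window_sub t : 0 <= t <= 2 * pi -> turns (t - pi) 1 `<=` turns (- pi) 2.
Proof.
move=> /andP[t0 t2] y; rewrite /turns /= !in_itv /= => /andP[ty yt].
by apply/andP; split; lra.
Qed.

Theorem fatou_radial_limit : exists2 u : R -> R, measurable_fun setT u &
  {ae mu, forall t, 0 <= t <= 2 * pi ->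
    complex.Re (W (polar r t)) @[r --> (1 : R)^'-] --> u t}.
Proof.
have mD := @measurable_turns R (- pi) 2; set D := turns _ _ in mD.
have [n_ [u0 [n_ge u0i taylor_u0]]] := boundary_function (- pi) 2 c_H2.
pose u := u0 \_ D; have uE y : D y -> u y = u0 y by move=> Dy; rewrite /u patchE mem_set.
exists u.
  by apply/(measurable_restrictT u0 mD)/measurable_EFinP; exact: measurable_int u0i.
have /lebesgue_differentiation := integrable_locally_restrict mD u0i.
apply: (@filterS _ _ (ae_filter_ringOfSetsType mu)) => t lebesgue_t t02.
have mI := @measurable_turns R (t - pi) 1; have ID := turns_window_sub t02.
have ui : mu.-integrable (turns (t - pi) 1) (EFin \o u).
  apply: eq_integrable (integrableS mD mI ID u0i) => // y /set_mem /ID Dy.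
  by rewrite /= uE.
have taylor_u : (fun k => \int[mu]_(y in turns (t - pi) 1)
    `|complex.Re (taylor c (n_ k) (polar 1 y)) - u y|)%R @ \oo --> (0 : R).
  have := cvg_Rintegral_dist_subset mD mI ID (fun k => Re_taylor_integrable _ _ _ _ _)
    u0i taylor_u0.
  rewrite [X in X @ _ --> _ -> _](_ : _ = fun k => \int[mu]_(y in turns (t - pi) 1)
    `|complex.Re (taylor c (n_ k) (polar 1 y)) - u y|)%R//.
  by apply/funext => k; apply: eq_Rintegral => y /set_mem /ID Dy; rewrite uE.
have pi2_neq0 : pi *+ 2 != 0 :> R by rewrite mulrn_eq0/= gt_eqF ?pi_gt0.
have := poisson_cvg_lebesgue_pt ui lebesgue_t.
move=> /(@cvgM _ _ _ _ (fun=> (pi *+ 2)^-1) _ _ _ (cvg_cst _)); rewrite mulKf//.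
apply: cvg_trans; apply: near_eq_cvg; near=> r.
rewrite /= (Rintegral_poisson_boundary _ n_ge ui taylor_u) ?mulKf//.
by near: r; exact: near_left1_between.
Unshelve. all: by end_near. Qed.

Lemma sqmean_radial_ge r x m K : 0 <= r < 1 ->
  mu.-integrable (turns x m) (EFin \o (fun t => cmod (W (polar r t)) ^+ 2)) /\
  (pi *+ 2 *+ m) * \sum_(k < K) cmod (c k) ^+ 2 * r ^+ (2 * k) <=
    (\int[mu]_(t in turns x m) (cmod (W (polar r t)) ^+ 2))%R.
Proof.
move=> r01; have mD := @measurable_turns R x m; have [r0 r1] := andP r01.
pose B := (1 + sqsum c) / (1 - r).
have taylor_le N t : cmod (taylor c N (polar r t)) <= B.
  by have := @cmod_taylor_H2_le _ c N (polar r t); rewrite cmod_polar//; exact.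
pose F N t := cmod (taylor c N (polar r t)) ^+ 2.
have mF N : measurable_fun (turns x m) (F N).
  apply: measurable_funTS; apply: continuous_measurable_fun.
  exact: continuous_cmod_taylor_sqr.
have F_W t : F ^~ t @ \oo --> cmod (W (polar r t)) ^+ 2.
  have := cvg_cmod_sqr (w := 0) (taylor_cvg t r01); rewrite sub0r cmodN.
  by under eq_fun do rewrite sub0r cmodN.
have [|||||Wi cv] := @cvg_Rintegral_bounded _ _ R mu _ mD (B ^+ 2)
  (fun t => cmod (W (polar r t)) ^+ 2) F.
- by rewrite /= lebesgue_measure_turns ltry.
- exact: mF.
- by apply: measurable_fun_cvg mF _ => t _; exact: F_W.
- move=> N t _; rewrite ger0_norm ?sqr_ge0// lerXn2r ?nnegrE ?cmod_ge0//.
  exact: le_trans (cmod_ge0 _) (taylor_le 0%N t).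
- by apply: aeW => t _; exact: F_W.
split=> //; apply: (cvgr_to_ge cv); exists K => // N /= KN; rewrite parseval.
rewrite ler_wpM2l ?turns_length_ge0//.
rewrite -(subnKC KN) big_split_ord/= lerDl sumr_ge0// => k _.
by rewrite mulr_ge0 ?sqr_ge0 ?exprn_ge0.
Qed.

Lemma sqmean_boundary_ge u v x m K : (forall z, cmod z < 1 -> cmod (W z) <= 1) ->
  measurable_fun (turns x m) u -> measurable_fun (turns x m) v ->
  {ae mu, forall t, turns x m t ->
    complex.Re (W (polar r t)) @[r --> (1 : R)^'-] --> u t /\
    complex.Im (W (polar r t)) @[r --> (1 : R)^'-] --> v t} ->
  mu.-integrable (turns x m) (EFin \o (fun t => u t ^+ 2 + v t ^+ 2)) /\
  (pi *+ 2 *+ m) * \sum_(k < K) cmod (c k) ^+ 2 <=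
    (\int[mu]_(t in turns x m) (u t ^+ 2 + v t ^+ 2))%R.
Proof.
move=> W_le1 m_u m_v radial; have mD := @measurable_turns R x m.
pose r_ n : R := 1 - harmonic n.
have r01 n : 0 <= r_ n < 1.
  by rewrite subr_ge0 gtrBl harmonic_gt0 andbT invf_le1// ler1n.
have r_cvg : r_ @ \oo --> (1 : R).
  rewrite -[X in _ --> X](subr0 1); apply: cvgB; first exact: cvg_cst.
  exact: cvg_harmonic.
have [|||||uvi cv] := @cvg_Rintegral_bounded _ _ R mu _ mD 1
  (fun t => u t ^+ 2 + v t ^+ 2) (fun n t => cmod (W (polar (r_ n) t)) ^+ 2).
- by rewrite /= lebesgue_measure_turns ltry.
- move=> n; apply/measurable_EFinP.
  by apply: measurable_int; exact: (sqmean_radial_ge x m 0 (r01 n)).1.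
- by apply: measurable_funD; exact: measurable_funX.
- move=> n t _; rewrite ger0_norm ?sqr_ge0// expr_le1 ?cmod_ge0// W_le1//.
  by have /andP[r0 r1] := r01 n; rewrite cmod_polar.
- apply: (@filterS _ _ (ae_filter_ringOfSetsType mu)) radial => t /[apply].
  move=> [/cvg_at_leftP Re_u /cvg_at_leftP Im_v].
  have seq_left : (forall n, r_ n < 1) /\ r_ @ \oo --> (1 : R).
    by split=> // n; case/andP: (r01 n).
  under eq_fun do rewrite cmod_sqr !expr2; rewrite !expr2.
  by apply: cvgD; apply: cvgM; (exact: Re_u seq_left || exact: Im_v seq_left).
split=> //; have sum_cvg : (fun n => (pi *+ 2 *+ m) *
    \sum_(k < K) cmod (c k) ^+ 2 * r_ n ^+ (2 * k)) @ \oo -->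
    (pi *+ 2 *+ m) * \sum_(k < K) cmod (c k) ^+ 2.
  apply: cvgM; first exact: cvg_cst.
  apply: cvg_big => [|k _]; first exact: add_continuous.
  rewrite -[X in _ --> X]mulr1 -(expr1n _ (2 * k)); apply: cvgM; first exact: cvg_cst.
  exact: (cvg_comp r_ _ r_cvg (@exprn_continuous R (2 * k) 1)).
apply: ler_cvg_to sum_cvg cv _; apply: nearW => n.
exact: (sqmean_radial_ge x m K (r01 n)).2.
Qed.

End RadialLimit.
End Fatou.

Section Inner.
Context {R : realType}.
Local Notation mu := (@lebesgue_measure R).
Local Notation C := R[i].
Local Notation h2 := (@h2 R).
Local Notation "''[' f , g ]" := (hdot f g).
Implicit Types (f theta : h2) (z : C) (r t : R) (u v : R -> R).

Definition szego z : h2 := insubd 0 (fun k => Num.conj (z ^+ k)).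

Definition h2eval f z : C := '[f, szego z].

Lemma szegoE z k : cmod z < 1 -> szego z k = Num.conj (z ^+ k).
Proof.
move=> z1; have sqr_lt1 : `|cmod z ^+ 2| < 1.
  by rewrite normrX exprn_ilt1// ger0_norm ?cmod_ge0.
rewrite -[LHS]/(val (szego z) k) val_insubd ifT//; apply/H2P.
rewrite /is_H2 (_ : (fun k => _) = geometric 1 (cmod z ^+ 2)).
  exact: is_cvg_geometric_series.
by apply/funext => j; rewrite /geometric/= mul1r cmod_conj cmodX exprAC.
Qed.

Lemma h2eval_cseries f z : cmod z < 1 -> cseries_to (fun k => f k * z ^+ k) (h2eval f z).
Proof.
move=> z1; have := hdot_cseries f (szego z); congr cseries_to.
by apply/funext => k; rewrite szegoE// conjCK.
Qed.

Lemma h2evalZ a f z : h2eval (a *: f) z = a * h2eval f z.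
Proof. exact: linearZl_LR. Qed.

Lemma h2eval_shift m f z : cmod z < 1 -> h2eval (h2shift m f) z = z ^+ m * h2eval f z.
Proof.
move=> z1; suff : cseries_to (fun k => h2shift m f k * z ^+ k) (z ^+ m * h2eval f z).
  exact: cvg_cmod_unique (h2eval_cseries (h2shift m f) z1).
have := cseries_to_zshift m (cseries_to_linear (z ^+ m) (h2eval_cseries f z1) cseries_to0).
rewrite addr0; congr cseries_to; apply/funext => k.
rewrite /= /zshift; case: leqP => [mk|_]; last by rewrite mul0r.
by rewrite addr0 mulrCA -exprD subnKC.
Qed.

(* Bessel's inequality for the Szego kernel at [z] reads
   [|theta z|^2 * \sum_k |z|^(2 k) <= \sum_k |z|^(2 k)]. *)
Lemma orthonormal_shifts_eval_le1 theta z :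
  orthonormal_shifts theta -> cmod z < 1 -> cmod (h2eval theta z) <= 1.
Proof.
move=> orth z1; have szego_cvg := sqsum_cvg (h2_is_H2 (szego z)).
have szego_gt0 : 0 < sqsum (szego z).
  apply: lt_le_trans (cmod_sqr_le_sqsum 0 (h2_is_H2 (szego z))).
  by rewrite szegoE// expr0 rmorph1 cmod1 expr1n.
rewrite -(@expr_le1 _ 2)// ?cmod_ge0// -(ler_pM2r szego_gt0) mul1r.
have scaled_cvg : (fun N => cmod (h2eval theta z) ^+ 2 *
    \sum_(k < N) cmod (szego z k) ^+ 2) @ \oo -->
    cmod (h2eval theta z) ^+ 2 * sqsum (szego z).
  by apply: cvgM => //; exact: cvg_cst.
apply: cvgr_to_le scaled_cvg _; apply: nearW => N; rewrite -sqnormE.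
apply: le_trans (bessel orth (szego z) N); rewrite mulr_sumr; apply: ler_sum => k _.
rewrite dotC cmod_conj -/(h2eval _ _) h2eval_shift// cmodM szegoE// cmod_conj.
by rewrite exprMn mulrC.
Qed.

Lemma orthonormal_shifts_sqsum theta : orthonormal_shifts theta -> sqsum theta = 1.
Proof.
move=> orth; have := orth 0 0; rewrite h2shift0 dot_self sqnormE.
by move=> /(congr1 (@complex.Re R)).
Qed.

Lemma radial_boundary_values theta : exists2 uv : (R -> R) * (R -> R),
  measurable_fun setT uv.1 /\ measurable_fun setT uv.2 &
  {ae mu, forall t, 0 <= t <= 2 * pi ->
    complex.Re (h2eval theta (polar r t)) @[r --> (1 : R)^'-] --> uv.1 t /\
    complex.Im (h2eval theta (polar r t)) @[r --> (1 : R)^'-] --> uv.2 t}.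
Proof.
have [u mu_u radial_u] := fatou_radial_limit (h2_is_H2 theta) (h2eval_cseries theta).
have [v mu_v radial_v] :=
  fatou_radial_limit (h2_is_H2 (- 'i%C *: theta)) (h2eval_cseries _).
exists (u, v) => //; apply: (@filterS2 _ _ (ae_filter_ringOfSetsType mu)) radial_u radial_v.
move=> t u_t v_t t02; split; first exact: u_t.
by have := v_t t02; under eq_fun do rewrite h2evalZ -Im_Re.
Qed.

(* The mean square of the boundary function is the norm of [theta], i.e. 1,
   while its modulus is at most 1. *)
Lemma boundary_unimodular theta u v (D := turns 0 1) : orthonormal_shifts theta ->
  measurable_fun setT u -> measurable_fun setT v ->
  {ae mu, forall t, D t ->
    complex.Re (h2eval theta (polar r t)) @[r --> (1 : R)^'-] --> u t /\
    complex.Im (h2eval theta (polar r t)) @[r --> (1 : R)^'-] --> v t} ->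
  {ae mu, forall t, D t -> u t ^+ 2 + v t ^+ 2 = 1}.
Proof.
move=> orth mu_u mu_v radial; have mD := @measurable_turns R 0 1.
have eval_le1 z := orthonormal_shifts_eval_le1 (z := z) orth.
have sqmean_ge K := sqmean_boundary_ge (h2_is_H2 theta) (h2eval_cseries theta) K eval_le1
  (measurable_funTS mu_u) (measurable_funTS mu_v) radial.
have one_i : mu.-integrable D (EFin \o (fun=> 1)).
  by apply: continuous_integrable_turns => t; exact: cvg_cst.
have deficit_i := integrable_EFinB mD one_i (sqmean_ge 0).1.
have deficit_ge0 : {ae mu, forall t, D t -> 0 <= 1 - (u t ^+ 2 + v t ^+ 2)}.
  apply: (@filterS _ _ (ae_filter_ringOfSetsType mu)) radial => t /[apply] -[Re_u Im_v].
  rewrite subr_ge0; apply: cvgr_to_le (_ : complex.Re (h2eval theta (polar r t)) ^+ 2 +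
    complex.Im (h2eval theta (polar r t)) ^+ 2 @[r --> (1 : R)^'-] --> _) _.
    by under eq_fun do rewrite !expr2; rewrite !expr2; apply: cvgD; apply: cvgM.
  near=> r; have /andP[r0 r1] : 0 <= r < 1 by near: r; exact: near_left1_between.
  by rewrite -cmod_sqr expr_le1 ?cmod_ge0// eval_le1// cmod_polar.
have deficit_int : (\int[mu]_(t in D) (1 - (u t ^+ 2 + v t ^+ 2)) <= 0)%R.
  rewrite RintegralB//; last exact: (sqmean_ge 0).1.
  rewrite Rintegral_turns_cst mul1r subr_le0.
  have partial_cvg : (fun K => (pi *+ 2 *+ 1) * \sum_(k < K) cmod (theta k) ^+ 2) @ \oo -->
      (pi *+ 2 *+ 1 : R).
    rewrite -[X in _ --> X]mulr1 -(orthonormal_shifts_sqsum orth).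
    apply: cvgM; first exact: cvg_cst.
    exact/sqsum_cvg/h2_is_H2.
  by apply: cvgr_to_le partial_cvg _; apply: nearW => K; exact: (sqmean_ge K).2.
apply: (@filterS _ _ (ae_filter_ringOfSetsType mu))
  (Rintegral_eq0_ae mD deficit_i deficit_ge0 deficit_int) => t /[apply].
by move=> /eqP; rewrite subr_eq0 => /eqP.
Unshelve. all: by end_near. Qed.

Theorem orthonormal_shifts_inner theta : orthonormal_shifts theta -> inner theta.
Proof.
move=> orth; have [[u v] [/= mu_u mu_v] radial] := radial_boundary_values theta.
have turnsE t : turns 0 1 t = (0 <= t <= 2 * pi).
  by rewrite /turns /= in_itv/= add0r mulr_natl.
have unimodular : {ae mu, forall t, turns 0 1 t -> u t ^+ 2 + v t ^+ 2 = 1}.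
  apply: boundary_unimodular orth mu_u mu_v _.
  by apply: (@filterS _ _ (ae_filter_ringOfSetsType mu)) radial => t; rewrite turnsE.
exists (h2eval theta); split.
  by split; [exact: h2eval_cseries|exists 1 => z; exact: orthonormal_shifts_eval_le1].
apply: (@filterS2 _ _ (ae_filter_ringOfSetsType mu)) radial unimodular => t.
rewrite turnsE => radial_t uv1 t02; exists (Complex (u t) (v t)); split.
  exact/cvg_cmodB/radial_t.
by rewrite /cmod/= uv1// sqrtr1.
Qed.

End Inner.

(** * Perturbed shifts *)

Section Polynomials.
Context {R : realType}.
Local Notation C := R[i].
Local Notation V := (nat -> R[i]).
Local Notation h2 := (@h2 R).
Local Notation "''[' f , g ]" := (hdot f g).
Implicit Types (f g : h2) (p q r : {poly C}).

Lemma coefs0 : coefs (0 : {poly C}) = 0.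
Proof. by apply/funext => k; rewrite /coefs coef0. Qed.

Lemma coefs_H2 p : coefs p \in H2.
Proof.
apply/H2P; pose B := \sum_(k < size p) cmod p`_k ^+ 2.
have [] // := @is_H2_sqsum_le R (coefs p) B => N.
apply: (@le_trans _ _ (\sum_(k < size p + N) cmod p`_k ^+ 2)).
  rewrite addnC big_split_ord/= lerDl sumr_ge0// => k _.
  by rewrite sqr_ge0.
rewrite big_split_ord/= [X in _ + X]big1 ?addr0// => k _.
by rewrite nth_default ?leq_addr// cmod0 expr0n.
Qed.

Definition h2poly p : h2 := H2Seq (coefs_H2 p).

Lemma h2poly_is_linear : linear h2poly.
Proof. by move=> a p q; apply: h2P => k; rewrite /= /coefs coefD coefZ. Qed.

HB.instance Definition _ := GRing.isLinear.Build C {poly C} h2 _ h2poly h2poly_is_linear.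

Lemma h2shift_poly m p : h2shift m (h2poly p) = h2poly ('X^m * p).
Proof. by apply: val_inj; rewrite /= coefs_XnM. Qed.

Lemma h2poly_Xn m : h2poly 'X^m = zpow m :> V.
Proof. by apply/funext => k; rewrite /= /coefs coefXn. Qed.

Lemma finite_coefs (h : V) K : (forall k, (K <= k)%N -> h k = 0) -> exists p, h = coefs p.
Proof.
move=> h0; exists (\poly_(k < K) h k); apply/funext => k.
by rewrite /coefs coef_poly; case: ltnP => // /h0.
Qed.

Lemma hdot_poly_shift q m f : (size q <= m)%N -> '[h2poly q, h2shift m f] = 0.
Proof.
move=> qm; apply: hdotE; have := @cseries_to0 R; congr cseries_to; apply/funext => k.
rewrite /= /zshift; case: leqP => [mk|_]; last by rewrite rmorph0 mulr0.
by rewrite /coefs nth_default ?mul0r// (leq_trans qm).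
Qed.

Lemma h2shift_eq_mod_poly m f g r : h2shift m f + h2poly r = h2shift m g ->
  f = g - h2poly (drop_poly m r).
Proof.
move=> fg; apply: h2P => k; rewrite -[RHS]/(g k - (drop_poly m r)`_k) coef_drop_poly.
have := congr1 (fun h : h2 => h (k + m)%N) fg.
rewrite -[LHS]/(zshift m f (k + m) + r`_(k + m)) -[RHS]/(zshift m g (k + m)) !zshift_addn.
by move=> <-; rewrite addrK.
Qed.

End Polynomials.

Section BoundedOperator.
Context {R : realType}.
Local Notation V := (nat -> R[i]).
Local Notation h2 := (@h2 R).
Variables (T : V -> V) (T_bounded : bounded_op T).

Lemma bounded_op_H2 (f : h2) : T f \in H2.
Proof. by case: T_bounded => TH2 _ _; apply/H2P/TH2; exact: h2_is_H2. Qed.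

Definition h2op (f : h2) : h2 := H2Seq (bounded_op_H2 f).

Lemma h2op_is_linear : linear h2op.
Proof.
move=> a f g; apply: val_inj; case: T_bounded => _ T_linear _.
exact: (T_linear a f g (h2_is_H2 f) (h2_is_H2 g)).
Qed.

HB.instance Definition _ := GRing.isLinear.Build R[i] h2 h2 _ h2op h2op_is_linear.

End BoundedOperator.

Section GradedSum.
Context {R : realType}.
Local Notation C := R[i].
Local Notation V := (nat -> R[i]).
Variables (n : nat) (phi : nat -> V) (theta : V).
Implicit Types (f g : V) (P : set V).

Definition graded_sum j : set V := [set f | exists (a : nat -> C) (g : V), is_H2 g /\
  f = (fun k => \sum_(j <= i < n) a i * phi i k + cmul (coefs 'X^n) (cmul theta g) k)].

Lemma graded_sum0E f : graded_sum 0 f <-> exists (a : nat -> C) (g : V),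
  is_H2 g /\ f = (fun k => \sum_(i < n) a i * phi i k + cmul (coefs 'X^n) (cmul theta g) k).
Proof.
by split=> -[a [g [Hg ->]]]; exists a, g; split=> //; apply/funext => k; rewrite big_mkord.
Qed.

Lemma graded_sum_mul j g : is_H2 g -> graded_sum j (cmul (coefs 'X^n) (cmul theta g)).
Proof.
move=> Hg; exists (fun=> 0), g; split=> //; apply/funext => k.
by rewrite big1 ?add0r// => i _; rewrite mul0r.
Qed.

Lemma graded_sum_term j i : (j <= i < n)%N -> graded_sum j (phi i).
Proof.
move=> jin; exists (fun k => (k == i)%:R), 0; split; first exact: (h2_is_H2 0).
apply/funext => k; rewrite !linear0 addr0 (bigD1_seq i) ?iota_uniq ?mem_index_iota//=.
by rewrite eqxx mul1r big1 ?addr0// => l /negbTE->; rewrite mul0r.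
Qed.

Lemma graded_sum_sub P j : (forall a f g, P f -> P g -> P (a *: f + g)) ->
  (forall i, (j <= i < n)%N -> P (phi i)) ->
  (forall g, is_H2 g -> P (cmul (coefs 'X^n) (cmul theta g))) -> graded_sum j `<=` P.
Proof.
move=> P_linear P_phi P_mul f [a [g [Hg ->]]].
rewrite (_ : (fun k => _) =
  \sum_(j <= i < n) a i *: phi i + cmul (coefs 'X^n) (cmul theta g)); last first.
  by apply/funext => k; rewrite fctE fct_sumE.
rewrite big_nat; elim/big_rec: _ => [|i h jin Ph]; first by rewrite add0r; exact: P_mul.
by rewrite -addrA; apply: P_linear => //; exact: P_phi.
Qed.

End GradedSum.

Section PerturbedShift.
Context {R : realType}.
Local Notation C := R[i].
Local Notation V := (nat -> R[i]).
Local Notation h2 := (@h2 R).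
Local Notation "''[' f , g ]" := (hdot f g).
Variables (n : nat) (F : V -> V).
Hypothesis F_perturbation : n_perturbation n F.
Implicit Types (f g phi theta : h2) (M : set h2).

Lemma perturbation_bounded : bounded_op F.
Proof. by case: F_perturbation. Qed.

Local Notation Fop := (h2op perturbation_bounded).

Lemma perturbation_poly m f : vanish_below m f ->
  exists2 p, Fop f = h2poly p & vanish_below m.+1 (coefs p).
Proof.
case: F_perturbation => _ _ F_poly _ /(F_poly m f (h2_is_H2 f))[p [FE p0]].
by exists p => //; exact: val_inj.
Qed.

Lemma perturbation_poly_eq0 p : vanish_below n (coefs p) -> Fop (h2poly p) = 0.
Proof.
move=> p0; rewrite -[p]coefK poly_def !linear_sum big1// => k _; rewrite !linearZ/=.
have [nk|kn] := leqP n k; last by rewrite [p`_k](p0 k kn) scale0r.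
rewrite (_ : Fop _ = 0) ?scaler0//; apply: val_inj; case: F_perturbation => _ F0 _ _.
by rewrite -[LHS]/(F (h2poly 'X^k)) h2poly_Xn F0.
Qed.

(* Truncating [f] below degree [N] does not change [F f], so that [F f] lies in
   [z^(N+1) C[z]] for every [N]. *)
Lemma perturbation_vanish f : vanish_below n f -> Fop f = 0.
Proof.
move=> f0; apply: h2P => N; pose p := \poly_(k < N) f k.
have p0 : vanish_below n (coefs p).
  by move=> k kn; rewrite /coefs coef_poly; case: ifP => // _; exact: f0.
have [r FE r0] : exists2 r, Fop (f - h2poly p) = h2poly r & vanish_below N.+1 (coefs r).
  apply: perturbation_poly => k kN.
  by rewrite -[LHS]/(f k - p`_k) coef_poly kN subrr.
have -> : Fop f = h2poly r by rewrite -FE linearB/= perturbation_poly_eq0// subr0.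
exact: r0.
Qed.

Definition perturbed_shift f : h2 := h2shift 1 f + Fop f.
Local Notation S := perturbed_shift.

Lemma perturbed_shiftE f : S f = Sop F f :> V.
Proof. by apply/funext => k; rewrite /Sop MzE. Qed.

Lemma perturbed_shift_is_linear : linear S.
Proof. by move=> a f g; rewrite /S !linearP scalerDr addrACA. Qed.

HB.instance Definition _ :=
  GRing.isLinear.Build C h2 h2 _ perturbed_shift perturbed_shift_is_linear.

Lemma perturbed_shift_vanish f : vanish_below n f -> S f = h2shift 1 f.
Proof. by move=> f0; rewrite /S perturbation_vanish// addr0. Qed.

Lemma perturbed_shift_order m f : vanish_below m f -> vanish_below m.+1 (S f).
Proof.
move=> f0 k km; rewrite -[LHS]/(zshift 1 f k + Fop f k).
have [p -> p0] := perturbation_poly f0; rewrite [h2poly p k]p0// addr0 -MzE.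
by case: k km => //= k; exact: f0.
Qed.

Lemma iter_perturbed_shift_order k m f :
  vanish_below m f -> vanish_below (m + k) (iter k S f).
Proof.
move=> f0; elim: k => [|k IH]; first by rewrite addn0.
by rewrite addnS; exact: perturbed_shift_order.
Qed.

Lemma iter_perturbed_shift_poly k f :
  exists r, iter k S f = h2shift k f + h2poly r.
Proof.
elim: k => [|k [r IH]]; first by exists 0; rewrite linear0 addr0 h2shift0.
have [//|p FE _] := @perturbation_poly 0 (iter k S f).
exists ('X * r + p); rewrite iterS /S FE IH !linearD/= -h2shiftD add1n h2shift_poly.
by rewrite addrA.
Qed.

Lemma perturbed_shift_eq0 f : S f = 0 -> f = 0.
Proof.
move=> Sf0; case: F_perturbation => _ _ _ [L [L_bounded LS]]; apply: val_inj.
rewrite /= -(LS f (h2_is_H2 f)) -perturbed_shiftE Sf0.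
by have := linear0 (h2op L_bounded) => /(congr1 (@h2val R)).
Qed.

Section InvariantSubspace.
Variable M : set h2.
Hypothesis clM : closed_submodule hdot M.
Hypothesis SM : forall f, M f -> M (S f).

Definition order_ge i : set h2 := M `&` [set f : h2 | vanish_below i f].

Lemma closed_submodule_order_ge i : closed_submodule hdot (order_ge i).
Proof. exact/(closed_submoduleI clM)/closed_submodule_vanish. Qed.

Lemma order_ge_le i j : (i <= j)%N -> order_ge j `<=` order_ge i.
Proof. by move=> ij f [Mf f0]; split=> //; exact: vanish_below_le f0. Qed.

(* A generator of [order_ge i] modulo [order_ge i.+1], a space of dimension at most
   one; it is [0] when the two spaces coincide. *)
Lemma graded_generator i : exists phi, [/\ order_ge i phi,
  forall g, order_ge i.+1 g -> '[phi, g] = 0 &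
  forall f, order_ge i f -> exists a, order_ge i.+1 (f - a *: phi)].
Proof.
have order_geS f : order_ge i f -> f i = 0 -> order_ge i.+1 f.
  by move=> [Mf f0] fi; split=> // k; rewrite ltnS leq_eqVlt => /orP[/eqP->|/f0].
have [[e [[Me e0] ei]]|none] := pselect (exists e, order_ge i e /\ e i != 0); last first.
  exists 0; split=> [|g _|f f_ge].
  - exact: closed_submodule0 (closed_submodule_order_ge i).
  - by rewrite linear0l.
  exists 0; rewrite scale0r subr0; apply: order_geS => //.
  by apply: contrapT => /eqP fi; apply: none; exists f.
have [u u_ge orth] := projection (closed_submodule_order_ge i.+1) (@h2_complete R) e.
have eu_ge : order_ge i (e - u).
  apply: (closed_submoduleB (closed_submodule_order_ge i)) => //.
  exact: order_ge_le u_ge.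
have euE : (e - u : h2) i = e i.
  by rewrite -[LHS]/(e i - u i) (u_ge.2 i (ltnSn i)) subr0.
exists (e - u); split=> // f f_ge; exists (f i / e i); apply: order_geS.
  by apply: (closed_submoduleB (closed_submodule_order_ge i)) => //;
    exact: (closed_submoduleZ (closed_submodule_order_ge i)).
by rewrite -[LHS]/(f i - f i / e i * (e - u : h2) i) euE divfK// subrr.
Qed.

Lemma iter_perturbed_shift_invariant k f : M f -> M (iter k S f).
Proof. by move=> Mf; elim: k => //= k; exact: SM. Qed.

Lemma order_ge_beurling f0 : M f0 -> f0 != 0 ->
  exists2 theta, orthonormal_shifts theta &
    forall f, order_ge n f <-> exists h : h2, f = zshift n (cmul theta h) :> V.
Proof.
move=> Mf0 f0_neq0; pose N : set h2 := [set g | M (h2shift n g)].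
have N_inv : shift_invariant N.
  split=> [|g Ng]; first exact: closed_submodule_unshift.
  rewrite /N /= -h2shiftD addnC h2shiftD -perturbed_shift_vanish; last exact: zshift_below.
  exact: SM.
have iter_vanish : vanish_below n (iter n S f0).
  exact: (@iter_perturbed_shift_order n 0).
have [g0 g0E] := h2_unshift iter_vanish.
have Ng0 : N g0 by rewrite /N /= -g0E; exact: iter_perturbed_shift_invariant.
have g0_neq0 : g0 != 0.
  apply: contra f0_neq0 => /eqP g00; move: g0E; rewrite g00 linear0 => iter0.
  apply/eqP; elim: (n) iter0 => // k IH /perturbed_shift_eq0.
  exact: IH.
have [theta orth NE] := beurling N_inv Ng0 g0_neq0; exists theta => // f; split.
  move=> [Mf /h2_unshift[g fE]]; have /NE[h gE] : N g by rewrite /N /= -fE.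
  by exists h; rewrite fE /= gE.
move=> [h fE]; have [g [gE _ _]] := orthonormal_shifts_mul h orth.
have -> : f = h2shift n g by apply: val_inj; rewrite /= gE.
by split; [apply/NE; exists h|exact: zshift_below].
Qed.

Section Generators.
Variable theta : h2.
Hypothesis orth : orthonormal_shifts theta.
Hypothesis order_geE :
  forall f, order_ge n f <-> exists h : h2, f = zshift n (cmul theta h) :> V.

Lemma order_ge_h2shift j : (n <= j)%N -> order_ge n (h2shift j theta).
Proof.
move=> nj; apply/order_geE; exists (h2poly 'X^(j - n)).
by rewrite cmulC cmul_Xn -zshiftD subnKC.
Qed.

(* Since [phi] is orthogonal to [z^j theta] for [j >= n] and differs from [z^i theta h]
   by a polynomial, the coefficients of [h] vanish from some point on. *)
Lemma generator_poly i phi : (i < n)%N -> order_ge i phi ->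
  (forall g, order_ge i.+1 g -> '[phi, g] = 0) ->
  exists p q, phi = zshift i (cmul (coefs p) theta) - coefs q :> V /\
    iter (n - i) S phi = zshift n (cmul (coefs p) theta) :> V.
Proof.
move=> ni [Mphi phi0] phi_orth; have in_ := ltnW ni.
have /order_geE[h iterE] : order_ge n (iter (n - i) S phi).
  split; first exact: iter_perturbed_shift_invariant.
  by rewrite -[n in vanish_below n](subnKC in_); exact: iter_perturbed_shift_order.
have [g [gE coord _]] := orthonormal_shifts_mul h orth.
have {}iterE : iter (n - i) S phi = h2shift n g by apply: h2P => k; rewrite iterE /= gE.
have [r iter_r] := iter_perturbed_shift_poly (n - i) phi.
have phiE : phi = h2shift i g - h2poly (drop_poly (n - i) r).
  by apply: h2shift_eq_mod_poly; rewrite -iter_r iterE -h2shiftD subnK.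
set q := drop_poly _ _ in phiE.
have [|p hE] := @finite_coefs R h (maxn n (size q)).
  move=> j; rewrite geq_max => /andP[nj qj]; rewrite -coord -(dot_h2shift i) -h2shiftD.
  rewrite (_ : h2shift i g = phi + h2poly q); last by rewrite phiE subrK.
  rewrite linearDl/= phi_orth ?hdot_poly_shift ?addr0//.
    exact: leq_trans (leq_addl _ _).
  by apply: (order_ge_le ni); apply: order_ge_h2shift; exact: leq_trans (leq_addl _ _).
exists p, q; rewrite iterE /= -hE cmulC -gE.
by rewrite -[LHS]/(h2val phi) phiE.
Qed.

Section GradedDecomposition.
Variable phi_ : nat -> h2.
Hypothesis phi_ge : forall i, (i < n)%N -> order_ge i (phi_ i).
Hypothesis generate : forall i f, (i < n)%N -> order_ge i f ->
  exists a, order_ge i.+1 (f - a *: phi_ i).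

Lemma graded_sum_order_ge j : (j <= n)%N ->
  graded_sum n phi_ theta j `<=` [set (f : V) | f in order_ge j].
Proof.
move=> jn; apply: graded_sum_sub => [a _ _ [f1 f1_ge <-] [f2 f2_ge <-]|i /andP[ji ni]|h].
- exists (a *: f1 + f2) => //; case: (closed_submodule_order_ge j) => _ order_linear _.
  exact: order_linear.
- by exists (phi_ i) => //; apply: (order_ge_le ji); exact: phi_ge.
- move=> /is_H2_h2[h' <-]; have [g [gE _ _]] := orthonormal_shifts_mul h' orth.
  exists (h2shift n g); last by rewrite cmul_Xn /= gE.
  by apply: (order_ge_le jn); apply/order_geE; exists h'; rewrite /= gE.
Qed.

Lemma order_ge_graded_sum j f : (j <= n)%N -> order_ge j f -> graded_sum n phi_ theta j f.
Proof.
move=> jn; rewrite -(subKn jn); elim: (n - j)%N (leq_subr j n) f => [_|d IH dn] f.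
  rewrite subn0 => /order_geE[h fE]; exists (fun=> 0), h; split; first exact: h2_is_H2.
  by rewrite fE cmul_Xn; apply/funext => k; rewrite big_geq// add0r.
set i := (n - d.+1)%N; have iS : i.+1 = (n - d)%N by rewrite /i subnSK.
have ni : (i < n)%N by rewrite iS leq_subr.
move=> /(generate ni)[a]; rewrite iS => /(IH (ltnW dn))[b [g [Hg bgE]]].
exists (fun k => if k == i then a else b k), g; split=> //; apply/funext => k.
rewrite big_ltn// eqxx iS.
have -> : \sum_(n - d <= l < n) (if l == i then a else b l) * phi_ l k =
    \sum_(n - d <= l < n) b l * phi_ l k.
  by apply: eq_big_nat => l /andP[]; rewrite -iS => il _; rewrite gtn_eqF.
have := congr1 (fun u => u k) bgE; rewrite -[LHS]/(f k - a * phi_ i k).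
by move=> /eqP; rewrite subr_eq => /eqP->; rewrite addrC addrA.
Qed.

End GradedDecomposition.

End Generators.

Theorem invariant_graded_sum f0 : M f0 -> f0 != 0 ->
  exists theta (phi_ : nat -> h2) (p q : nat -> {poly C}), [/\ orthonormal_shifts theta,
    forall i, phi_ i = cmul (coefs ('X^i * p i)) theta - coefs (q i) :> V,
    forall i, (i < n)%N -> order_ge i (phi_ i) /\
      iter (n - i) S (phi_ i) = cmul (coefs ('X^n * p i)) theta :> V,
    forall i g, (i < n)%N -> order_ge i.+1 g -> '[phi_ i, g] = 0 &
    forall j, (j <= n)%N -> graded_sum n phi_ theta j = [set (f : V) | f in order_ge j]].
Proof.
move=> Mf0 f0_neq0; have [theta orth order_geE] := order_ge_beurling Mf0 f0_neq0.
have /choice[gen genP] i : exists t : h2 * ({poly C} * {poly C}),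
    t.1 = cmul (coefs ('X^i * t.2.1)) theta - coefs t.2.2 :> V /\
    ((i < n)%N -> [/\ order_ge i t.1,
      iter (n - i) S t.1 = cmul (coefs ('X^n * t.2.1)) theta :> V,
      forall g, order_ge i.+1 g -> '[t.1, g] = 0 &
      forall f, order_ge i f -> exists a, order_ge i.+1 (f - a *: t.1)]).
  have [ni|ni] := ltnP i n; last first.
    by exists (0, (0, 0)); rewrite /= mulr0 cmulC coefs0 linear0 subr0.
  have [phi [phi_ge phi_orth phi_gen]] := graded_generator i.
  have [p [q [phiE iterE]]] := generator_poly orth order_geE ni phi_ge phi_orth.
  by exists (phi, (p, q)); split=> [|_]; [|split=> //]; rewrite /= cmul_XnM.
exists theta, (fun i => (gen i).1), (fun i => (gen i).2.1), (fun i => (gen i).2.2).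
split=> // [i|i ni|i g ni|j jn]; first by case: (genP i).
- by have [_ /(_ ni)[]] := genP i.
- by have [_ /(_ ni)[_ _ + _]] := genP i; exact.
- apply/seteqP; split=> [|_ [f f_ge <-]].
    by apply: graded_sum_order_ge => // i ni; have [_ /(_ ni)[]] := genP i.
  apply: order_ge_graded_sum f_ge => // i g ni; have [_ /(_ ni)[_ _ _]] := genP i.
  exact.
Qed.

End InvariantSubspace.

Theorem invariant_decomposition (M : set V) : closed_subspace M ->
  (forall f : V, M f -> M (Sop F f)) -> (exists f : V, M f /\ f <> (fun=> 0)) ->
  exists (theta : V) (phi_ : nat -> V) (p q : nat -> {poly C}), [/\ inner theta,
    forall i, phi_ i = cmul (coefs ('X^i * p i)) theta - coefs (q i),
    forall f : V, M f <-> graded_sum n phi_ theta 0 f,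
    forall i (g : V), (i < n)%N -> graded_sum n phi_ theta i.+1 g ->
      h2orth (phi_ i) g /\ h2orth g (phi_ i) &
    (forall j, (j < n)%N -> graded_sum n phi_ theta j.+1 (Sop F (phi_ j))) /\
    ((0 < n)%N -> Sop F (phi_ n.-1) = cmul (coefs ('X^n * p n.-1)) theta)].
Proof.
move=> clM SM [f [Mf f_neq0]]; have [f0 f0E Mf0] := closed_subspace_h2 clM Mf.
have f0_neq0 : f0 != 0 by apply/eqP => f00; apply: f_neq0; rewrite -f0E f00.
have clM' := closed_subspace_submodule clM; set M' := [set f : h2 | M f] in clM'.
have SM' g : M' g -> M' (S g).
  by move=> Mg; rewrite -[M' _]/(M (S g)) perturbed_shiftE; exact: SM.
have [theta [phi_ [p [q [orth phiE phi_ge phi_orth graded]]]]] :=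
  invariant_graded_sum clM' SM' Mf0 f0_neq0.
exists theta, phi_, p, q; split=> // [|g|i g ni|].
- exact: orthonormal_shifts_inner.
- rewrite graded//; split=> [Mg|[g' [Mg' _] <-//]].
  by have [g' gE Mg'] := closed_subspace_h2 clM Mg; exists g'.
- rewrite graded// => -[g' g_ge <-]; have g_orth := phi_orth i g' ni g_ge.
  by split; apply: hdot_h2orth => //; exact: dot_eq0C.
split=> [j jn|n0].
  have [[Mphi phi0] _] := phi_ge j jn; rewrite graded// -perturbed_shiftE.
  by exists (S (phi_ j)) => //; split; [exact: SM'|exact: perturbed_shift_order].
have pn : (n.-1 < n)%N by rewrite prednK.
have [_ <-] := phi_ge _ pn; rewrite -perturbed_shiftE.
by rewrite -subn1 subKn.
Qed.

Theorem graded_sum_invariant (M : set V) (phi_ : nat -> V) (theta : V) :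
  closed_subspace M -> (forall f : V, M f <-> graded_sum n phi_ theta 0 f) ->
  (forall j, (j < n)%N -> graded_sum n phi_ theta j.+1 (Sop F (phi_ j))) ->
  forall f : V, M f -> M (Sop F f).
Proof.
move=> clM ME S_phi; have M_linear a (f g : V) : M f -> M g -> M (a *: f + g).
  by case: clM => _ _ + _; exact.
have M_phi i : (i < n)%N -> M (phi_ i) by move=> ni; exact/ME/graded_sum_term.
have M_mul (g : V) : is_H2 g -> M (cmul (coefs 'X^n) (cmul theta g)).
  by move=> Hg; exact/ME/graded_sum_mul.
have S_mul (g : V) : is_H2 g -> M (Sop F (cmul (coefs 'X^n) (cmul theta g))).
  move=> Hg; have [f fE Mf] := closed_subspace_h2 clM (M_mul g Hg).
  rewrite -fE -perturbed_shiftE perturbed_shift_vanish; last first.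
    by rewrite fE cmul_Xn; exact: zshift_below.
  have [h hE] := is_H2_h2 Hg; rewrite -hE in fE.
  rewrite /= fE cmul_Xn -zshiftD addnC zshiftD -cmul_zshift -cmul_Xn.
  exact/M_mul/(h2_is_H2 (h2shift 1 h)).
suff sub : graded_sum n phi_ theta 0 `<=` M `&` [set f : V | M (Sop F f)].
  by move=> f /ME/sub[].
apply: graded_sum_sub.
- move=> a f1 f2 [/= Mf1 Sf1] [Mf2 Sf2]; split; first exact: M_linear.
  have [g1 g1E _] := closed_subspace_h2 clM Mf1.
  have [g2 g2E _] := closed_subspace_h2 clM Mf2.
  have SE : Sop F (a *: f1 + f2) = a *: Sop F f1 + Sop F f2.
    rewrite -g1E -g2E -!perturbed_shiftE.
    exact: etrans (esym (perturbed_shiftE _)) (congr1 h2val (linearP perturbed_shift a g1 g2)).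
  by rewrite /= SE; exact: M_linear.
- move=> i ni; split; first exact: M_phi.
  move: (S_phi i ni); apply: graded_sum_sub => // j /andP[_]; exact: M_phi.
- by move=> g Hg; split; [exact: M_mul|exact: S_mul].
Qed.

End PerturbedShift.

Theorem theorem3p2 (R : realType) (n : nat) (F : (nat -> R[i]) -> (nat -> R[i]))
    (M : set (nat -> R[i])) :
  (1 <= n)%N ->
  n_perturbation n F ->
  closed_subspace M ->
  (exists f, M f /\ f <> (fun _ => 0)) ->
  (forall f, M f -> M (Sop F f))
  <->
  (exists (theta : nat -> R[i]) (p q : nat -> {poly R[i]}),
     let phi := fun i : nat => (fun k => cmul (coefs ('X^i * p i)) theta k - coefs (q i) k) in
     let zth := fun g : nat -> R[i] => cmul (coefs 'X^n) (cmul theta g) in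
     inner theta /\ (
         (* M = (C phi_0 (+) ... (+) C phi_(n-1)) (+) z^n theta H^2 *)
         forall f, M f <-> exists (a : nat -> R[i]) (g : nat -> R[i]),
            is_H2 g /\ f = (fun k => \sum_(i < n) a i * phi i k + zth g k)) /\ [/\
         (* the sums are orthogonal *)
         forall i j, (i < n)%N -> (j < n)%N -> i <> j -> h2orth (phi i) (phi j),
         forall i g, (i < n)%N -> is_H2 g -> h2orth (phi i) (zth g),
         (* S_n phi_j in (C phi_(j+1) (+) ... (+) C phi_(n-1)) (+) z^n theta H^2 *)
         forall j, (j.+1 < n)%N -> exists (a : nat -> R[i]) (g : nat -> R[i]),
            is_H2 g /\ Sop F (phi j) = (fun k => \sum_(j.+1 <= i < n) a i * phi i k + zth g k)
       & (* S_n phi_(n-1) = z^n p_(n-1) theta *)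
         Sop F (phi n.-1) = cmul (coefs ('X^n * p n.-1)) theta]).
Proof.
move=> n_gt0 nF clM M_neq0; split=> [SM|[theta [p [q]]]].
  have [theta [phi_ [p [q [theta_inner phiE ME phi_orth [S_phi S_last]]]]]] :=
    invariant_decomposition nF clM SM M_neq0.
  exists theta, p, q => phi zth; have -> : phi = phi_ by apply/funext => i; rewrite phiE.
  split=> //; split=> [f|]; first by rewrite ME graded_sum0E.
  split=> [i j ni nj /eqP ij|i g ni Hg|j jn|]; last exact: S_last.
  - have [lt_ij|lt_ji] := ltnP i j.
      by apply: (phi_orth i (phi_ j) ni _).1; apply: graded_sum_term; rewrite lt_ij.
    have {}lt_ji : (j < i)%N by rewrite ltn_neqAle eq_sym ij.
    by apply: (phi_orth j (phi_ i) nj _).2; apply: graded_sum_term; rewrite lt_ji.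
  - by apply: (phi_orth i (zth g) ni _).1; exact: graded_sum_mul.
  - exact/S_phi/ltnW.
set phi := fun i k => _ => -[_ [ME [_ _ S_phi S_last]]].
apply: (@graded_sum_invariant _ _ _ nF M phi theta) => // [f|j jn].
  exact: iff_trans (ME f) (iff_sym (graded_sum0E _ _ _ _)).
have [nj|/S_phi//] := leqP n j.+1.
have -> : j = n.-1 by apply/eqP; rewrite -eqSS prednK// eqn_leq jn.
by rewrite S_last cmul_XnM cmulC -cmul_Xn; apply: graded_sum_mul; exact/H2P/coefs_H2.
Qed.
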